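(* Let $k$ and $t$ be integers such that $k>t\ge 2$. Then there exists $n_0$ (depending on $k$ and $t$) such that for every integer $n\ge n_0$ there exists a $t$-$(n,k,\{1,2\})$-design; that is, there exists a $k$-uniform hypergraph on $n$ vertices such that every set of $t$ distinct vertices is contained in exactly one or exactly two edges.
   Context: Let $n,k,t$ be positive integers satisfying $n>k>t\ge 2$ and let $\Lambda$ be a set of positive integers. A $t$-$(n,k,\Lambda)$-design is a $k$-uniform hypergraph $\mathcal{H}=(X,\mathcal{F})$ on $n$ vertices (so $|X|=n$ and $\mathcal{F}$ is a set of $k$-element subsets of $X$, called edges) such that for every $t$-element set $A\subset X$, the number of edges $F\in\mathcal{F}$ with $A\subseteq F$ belongs to $\Lambda$. *)

(* Defs.v *)
From mathcomp Require Import all_boot.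

Set Implicit Arguments.
Unset Strict Implicit.
Unset Printing Implicit Defensive.

Definition uniform_hypergraph (X : finType) (k : nat) (F : {set {set X}}) : Prop :=
  forall e : {set X}, e \in F -> #|e| = k.

Definition codegree (X : finType) (F : {set {set X}}) (A : {set X}) : nat :=
  #|[set e in F | A \subset e]|.

(* The hypergraph (X, F) is a t-(n, k, Lambda)-design.  The first two fields
   are the standing assumptions on the parameters: n > k > t >= 2, and Lambda
   is a set of positive integers. *)
Record is_design (t n k : nat) (Lambda : {pred nat})
    (X : finType) (F : {set {set X}}) : Prop := IsDesign {
  design_params : [/\ 2 <= t, t < k & k < n];
  design_Lambda_gt0 : forall d : nat, d \in Lambda -> 0 < d;
  design_order : #|X| = n;
  design_uniform : uniform_hypergraph k F;
  design_codegree : forall A : {set X}, #|A| = t -> codegree F A \in Lambda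
}.

(* Main.v *)
Require Import Defs.
From HB Require Import structures.
From mathcomp Require Import all_boot all_order all_fingroup all_algebra all_field.
From mathcomp Require Import reals Rstruct sequences exp.
From mathcomp Require Import zify ring lra.

Set Implicit Arguments.
Unset Strict Implicit.
Unset Printing Implicit Defensive.

(** Call a family of [k]-sets a packing if two distinct members share fewer than
[t] points; every [t]-set then lies in at most one member.  The theorem is the
combination of two facts.

(1) [near_perfect_packing]: for each [e] and all large [n] there is a packing
on [n] points such that each [(t-1)]-set [S] has at most [n/e] points [y] for
which [S + y] is uncovered.

(2) [augment_packing]: such a packing can be completed.  Each uncovered [t]-set
[T] receives a block of its own, which contains no other uncovered [t]-set, in
such a way that two of the new blocks share fewer than [t] points.  Then an
uncovered [t]-set lies in exactly one block of the final family, and a covered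
one lies in its old block and in at most one new block.  The new blocks form an
independent transversal: a random extension of [T] is admissible with
probability at least one half and, the uncovered sets being thin, it conflicts
with a small fraction of the extensions of all the other sets.  Rosenfeld's
counting argument ([independent_transversal]) turns this into existence.

Fact (1) starts from [inner_packing], a packing of [m] points that misses a
small fraction of all [t]-sets.  It is algebraic.  The points are [M] disjoint
copies of [F^d] for a finite field [F].  To every set [T] of [t] copies belongs
a linear functional on [(F^d)^T].  For every set [K] of [k] copies,
[code_exists] gives a linear code in [(F^d)^K] on which all functionals of
subsets of [K] vanish and in which a word is determined by any [t] of its
entries.  Each [K] contributes several translates of its code, and the values
that the functional of [T] takes on these translates are distinct over all the
[K] that contain [T].  So a [t]-set that meets [t] copies knows from the value
of its functional which [K] and which translate can contain it
([algebraic_packing]).  Counting blocks shows that little is missed.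

To control every single [S] the inner packings are randomized
([exists_spread_packing]) and spread over a plane.  Put the [n] points into
[F * F] with [#|F|^2] close to [n].  For a slope [a], the plane is filled by the
curves [x2 = g (x1 + a x2)] with [g] a polynomial of degree less than [t]; by
interpolation a [t]-set on which [x1 + a x2] is injective lies in exactly one
of them.  On every curve, place a randomly permuted inner packing.  The curves
through a fixed [S] are disjoint outside [S], so the number of bad [y] is a sum
of independent terms, and a Chernoff bound beats the number of choices of [S]
([concentration], [one_direction]).

A single slope is useless for those [S] that contain two points with the same
value of [x1 + a x2].  Such a pair agrees for one slope only, hence each [S] is
separated by one of [t^2 + 1] slopes.  From the packing of slope [j] keep only
the blocks that no earlier slope separates, and then delete the blocks that
share [t] points with a block kept for a later slope.  Let [j] be the first
slope that separates [S].  The blocks through [S] of slope [j] are all kept,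
because [S] itself is not separated earlier.  One of them is deleted only if
one of its [t]-sets, which slope [j] separates, lies in a block of a later
slope that slope [j] does not separate; this is rare, since on a curve of the
later slope a random block hardly ever contains two points that agree for slope
[j] ([random_collision], [combined_uncovered]). *)

(** * Packings *)

Definition packing (V : finType) (t k : nat) (Q : {set {set V}}) : Prop :=
  (forall K : {set V}, K \in Q -> #|K| = k) /\
  (forall K K' : {set V}, K \in Q -> K' \in Q -> t <= #|K :&: K'| -> K = K').

Definition uncovered (V : finType) (t : nat) (Q : {set {set V}}) : {set {set V}} :=
  [set T : {set V} | (#|T| == t) && ~~ [exists K in Q, T \subset K]].

(** * Counting tools *)

Definition fupd (J : finType) (W : Type) (f : {ffun J -> W}) (a : J) (y : W) :=
  [ffun x => if x == a then y else f x].

Lemma leq_card_bigcup (I X : finType) (P : pred I) (F : I -> {set X}) :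
  #|\bigcup_(i | P i) F i| <= \sum_(i | P i) #|F i|.
Proof.
elim/big_ind2: _ => [|a A b B hA hB|//]; first by rewrite cards0.
by apply: leq_trans (leq_card_setU _ _) _; rewrite leq_add.
Qed.

Lemma card_bigcup_bound (I X : finType) (P : {set I}) (F : I -> {set X}) c d :
  (forall i, i \in P -> c * #|F i| <= d) ->
  c * #|\bigcup_(i in P) F i| <= #|P| * d.
Proof.
move=> h; apply: leq_trans (leq_mul (leqnn c) (leq_card_bigcup _ _)) _.
by rewrite big_distrr -sum_nat_const leq_sum.
Qed.

Lemma exists_injection (A B : finType) : #|A| <= #|B| -> exists f : A -> B, injective f.
Proof.
move=> AB; exists (fun x => enum_val (widen_ord AB (enum_rank x))) => x y /enum_val_inj E.
by apply: enum_rank_inj; apply: val_inj; move/(congr1 val): E.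
Qed.

Lemma sum_card_fibers (I X : finType) (P : I -> pred X) :
  \sum_i #|[set x | P i x]| = #|[set p : I * X | P p.1 p.2]|.
Proof.
under eq_bigr => i _ do rewrite -sum1_card.
rewrite pair_big_dep /= -sum1_card.
by apply: eq_bigl => p; rewrite !inE.
Qed.

(** Changing the value at [a] while remembering the old value is injective on
pairs, so the lines in direction [a], summed over all functions, count each
element of [X] exactly [#|V|] times. *)
Lemma leq_card_ffun_fibers (J V : finType) (a : J) (X : {set {ffun J -> V}}) c :
  (forall f, c * #|[set y | fupd f a y \in X]| <= #|V|) ->
  c * #|X| <= #|V| ^ #|J|.
Proof.
move=> h; have [V0|V0] := posnP #|V|.
  suff -> : X = set0 by rewrite cards0 muln0.
  apply/setP => f; rewrite inE; apply/negP => _.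
  by have := fintype0 (f a); rewrite V0; apply.
suff : #|V| * (c * #|X|) <= #|V| * (#|V| ^ #|J|) by rewrite leq_pmul2l.
apply: (@leq_trans (c * \sum_(f : {ffun J -> V}) #|[set y | fupd f a y \in X]|)); last first.
  rewrite big_distrr /= mulnC -card_ffun -sum_nat_const.
  by apply: leq_sum => f _; apply: h.
rewrite mulnCA leq_mul2l; apply/orP; right.
rewrite mulnC -[#|V|]cardsT -cardsX.
pose G (p : {ffun J -> V} * V) := (fupd p.1 a p.2, p.1 a).
have fuu (f : {ffun J -> V}) y : fupd (fupd f a y) a (f a) = f.
  by apply/ffunP => x; rewrite !ffunE; case: eqP => [->|].
have Ginj : injective G.
  move=> [f y] [g z] [/= E1 E2]; have := fuu f y; rewrite E1 E2 fuu => <-.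
  by move/ffunP/(_ a): E1; rewrite !ffunE eqxx => ->.
rewrite -(card_imset _ Ginj).
rewrite (sum_card_fibers (fun f y => fupd f a y \in X)).
apply/subset_leq_card/subsetP => _ /imsetP[[f y] + ->]; rewrite !inE /= fuu.
by case/andP.
Qed.

Lemma card_ffun_into (J V : finType) (A : {set J}) (U : {set V}) :
  #|V| ^ #|A| * #|[set f : {ffun J -> V} | f @: A \subset U]| <=
  #|U| ^ #|A| * #|V| ^ #|J|.
Proof.
pose F (a : J) : pred V := [pred y | (a \in A) ==> (y \in U)].
have -> : #|[set f : {ffun J -> V} | f @: A \subset U]| =
    #|U| ^ #|A| * #|V| ^ #|~: A|.
  transitivity #|(family F : simpl_pred {ffun J -> V})|.
    apply: eq_card => f; rewrite !inE; apply/subsetP/familyP => [h a|h x].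
      by rewrite inE; apply/implyP => aA; apply: h; apply: imset_f.
    by case/imsetP=> a aA ->; move: (h a); rewrite inE aA.
  rewrite card_family foldrE big_map big_enum /=.
  rewrite (bigID (mem A)) /= -!prod_nat_const; congr (_ * _).
    by apply: eq_bigr => a aA; apply: eq_card => y; rewrite !inE aA.
  apply: eq_big => a; first by rewrite inE.
  by move=> /negbTE aA; apply: eq_card => y; rewrite !inE aA.
rewrite mulnCA leq_mul2l -expnD; apply/orP; right.
by rewrite cardsC leqnn.
Qed.

(** * Independent transversals *)

Section IndependentTransversal.

Variables (L W : finType) (opts : L -> {set W}) (conf : L -> W -> L -> W -> bool).
Variable N : nat.
Hypothesis N_gt0 : 0 < N.
Hypothesis conf_sym : forall T Z T' Z', conf T Z T' Z' = conf T' Z' T Z.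
Hypothesis size_opts : forall T, N <= #|opts T|.
Hypothesis deg_conf : forall T Z, Z \in opts T ->
  4 * #|[set p : L * W | [&& p.1 != T, p.2 \in opts p.1 & conf T Z p.1 p.2]]| <= N.

(** A choice of one option for each member of [A] and [None] elsewhere, so that
restriction and extension are changes of one value. *)
Definition partial_transversals (A : {set L}) : {set {ffun L -> option W}} :=
  [set phi : {ffun L -> option W} |
    [forall T, if phi T is Some Z then (T \in A) && (Z \in opts T) else T \notin A] &&
    [forall T, forall T', (T != T') ==>
      (if phi T is Some Z then
         if phi T' is Some Z' then ~~ conf T Z T' Z' else true else true)]].

Lemma restrict_transversal A (phi : {ffun L -> option W}) T :
  phi \in partial_transversals A -> fupd phi T None \in partial_transversals (A :\ T).
Proof.
rewrite !inE => /andP[/forallP h1 /forallP h2]; apply/andP; split.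
  apply/forallP => x; rewrite ffunE !inE; case: eqP => [//|_] /=; exact: h1.
apply/forallP => x; apply/forallP => y; apply/implyP => xy; rewrite !ffunE.
case: eqP => // _; case: (y =P T) => [_|_]; first by case: (phi x).
exact: (implyP (forallP (h2 x) y)).
Qed.

Lemma extend_transversal A (phi : {ffun L -> option W}) T Z :
  phi \in partial_transversals A -> Z \in opts T -> T \notin A ->
  (forall T' Z', phi T' = Some Z' -> ~~ conf T Z T' Z') ->
  fupd phi T (Some Z) \in partial_transversals (T |: A).
Proof.
rewrite !inE => /andP[/forallP h1 /forallP h2] ZT TA noc; apply/andP; split.
  apply/forallP => x; rewrite ffunE !inE; case: eqP => [-> //|_] /=; exact: h1.
apply/forallP => x; apply/forallP => y; apply/implyP => xy; rewrite !ffunE.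
case: (x =P T) xy => [->|_] xy; case: (y =P T) xy => [->|_] xy; rewrite ?eqxx // in xy *.
- by case E: (phi y) => [Z'|//]; exact: noc.
- by case E: (phi x) => [Z'|//]; rewrite conf_sym; exact: noc.
- exact: (implyP (forallP (h2 x) y)).
Qed.

(** Erasing the option [p.2] at [p.1] is injective on the transversals that use
it. *)
Lemma transversals_through A p :
  N * #|[set phi in partial_transversals A | phi p.1 == Some p.2]| <=
  (p.1 \in A) * (N * #|partial_transversals (A :\ p.1)|).
Proof.
case pA: (p.1 \in A); last first.
  rewrite mul0n leqn0 muln_eq0 cards_eq0; apply/orP; right; apply/eqP/setP => phi.
  rewrite !inE; apply/negP => /andP[/andP[/forallP/(_ p.1) + _] /eqP E].
  by rewrite E pA.
rewrite mul1n leq_mul2l; apply/orP; right.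
rewrite -(card_in_imset (f := fun phi => fupd phi p.1 None)); last first.
  move=> phi psi; rewrite inE => /andP[_ /eqP E1]; rewrite inE => /andP[_ /eqP E2] E.
  apply/ffunP => x; move/ffunP/(_ x): E; rewrite !ffunE.
  by case: eqP => [-> _|//]; rewrite E1 E2.
apply/subset_leq_card/subsetP => _ /imsetP[phi + ->]; rewrite inE => /andP[h _].
exact: restrict_transversal.
Qed.

(** Extend each transversal of [A] by each option of [T].  An extension fails
because of some conflicting option [Z'] of some [T'] in [A]; by the growth from
[A :\ T'] to [A], at most a fraction [2/N] of the transversals use [Z'].  Each
option of [T] has at most [N/4] conflicts, so at most half of the extensions
fail. *)
Lemma transversal_growth_step (A : {set L}) T : T \notin A ->
  (forall T', T' \in A ->
     N * #|partial_transversals (A :\ T')| <= 2 * #|partial_transversals A|) ->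
  N * #|partial_transversals A| <= 2 * #|partial_transversals (T |: A)|.
Proof.
move=> TA IH; pose I := partial_transversals A.
pose C Z := [set p : L * W | [&& p.1 != T, p.2 \in opts p.1 & conf T Z p.1 p.2]].
pose bad := \bigcup_(Z in opts T) \bigcup_(p in C Z)
   setX [set phi in I | phi p.1 == Some p.2] [set Z].
have bad_le : 2 * #|bad| <= #|opts T| * #|I|.
  suff : 2 * N * (2 * #|bad|) <= 2 * N * (#|opts T| * #|I|).
    by rewrite leq_pmul2l // muln_gt0 N_gt0.
  apply: (@leq_trans (4 * \sum_(Z in opts T) \sum_(p in C Z) 2 * #|I|)).
    have -> : 2 * N * (2 * #|bad|) = 4 * (N * #|bad|) by lia.
    rewrite leq_mul2l /=; apply: leq_trans (leq_mul (leqnn N) (leq_card_bigcup _ _)) _.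
    rewrite big_distrr leq_sum // => Z ZT.
    apply: leq_trans (leq_mul (leqnn N) (leq_card_bigcup _ _)) _.
    rewrite big_distrr leq_sum // => p pC /=.
    rewrite cardsX cards1 muln1; apply: leq_trans (transversals_through _ _) _.
    by case pA: (p.1 \in A); rewrite ?mul0n // mul1n; apply: IH.
  have -> : 2 * N * (#|opts T| * #|I|) = \sum_(Z in opts T) 2 * N * #|I|.
    by rewrite sum_nat_const; lia.
  rewrite big_distrr leq_sum // => Z ZT /=; rewrite sum_nat_const.
  have := deg_conf ZT; rewrite -/(C Z) => h.
  by move: (leq_mul h (leqnn (2 * #|I|))); move: #|C Z| #|I| => c i; lia.
(* The extensions that survive are pairwise different. *)
have good_le : #|setX I (opts T) :\: bad| <= #|partial_transversals (T |: A)|.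
  rewrite -(card_in_imset (f := fun p => fupd p.1 T (Some p.2))); last first.
    move=> [phi Z] [psi Z']; rewrite !inE /= => /andP[_ /andP[hphi _]] /andP[_ /andP[hpsi _]] E.
    have NA (f : {ffun L -> option W}) : f \in I -> f T = None.
      rewrite inE => /andP[/forallP/(_ T) + _].
      by case: (f T) => // Z0; rewrite (negbTE TA).
    congr pair; last by move/ffunP/(_ T): E; rewrite !ffunE eqxx => -[].
    apply/ffunP => x; move/ffunP/(_ x): E; rewrite !ffunE; case: eqP => [-> _|//].
    by rewrite !NA // inE.
  apply/subset_leq_card/subsetP => _ /imsetP[[phi Z] hphiZ ->] /=.
  move: hphiZ; rewrite in_setD in_setX /= => /andP[nbad /andP[hphi ZT]].
  apply: extend_transversal => //.
  move=> T' Z' E; apply: contra nbad => cf.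
  have hT' : (T' \in A) && (Z' \in opts T').
    by move: hphi; rewrite inE => /andP[/forallP/(_ T')]; rewrite E.
  apply/bigcupP; exists Z => //; apply/bigcupP; exists (T', Z').
    rewrite inE /= cf; case/andP: hT' => h -> /=; rewrite andbT.
    by apply: contraNneq TA => <-.
  by rewrite in_setX in_set1 eqxx andbT inE hphi /= E.
have split_le : #|setX I (opts T)| <= #|setX I (opts T) :\: bad| + #|bad|.
  rewrite -(cardsID bad (setX I (opts T))) addnC leq_add2l.
  by apply: subset_leq_card; apply: subsetIr.
rewrite cardsX in split_le.
have := leq_mul (size_opts T) (leqnn #|I|); rewrite -/I.
by move: split_le bad_le good_le; move: #|bad| => b; lia.
Qed.

Lemma transversal_growth n (A : {set L}) T : #|A| <= n -> T \notin A ->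
  N * #|partial_transversals A| <= 2 * #|partial_transversals (T |: A)|.
Proof.
elim: n A T => [|n IH] A T An TA; apply: transversal_growth_step => // T' T'A.
  by move: An; rewrite leqn0 cards_eq0 => /eqP A0; rewrite A0 inE in T'A.
rewrite -{2}(setD1K T'A); apply: IH; last by rewrite !inE eqxx.
by move: An; rewrite (cardsD1 T') T'A.
Qed.

(** Rosenfeld's counting argument: the number of partial transversals grows by a
factor at least [N/2] with every new member, hence it is never zero. *)
Lemma independent_transversal :
  exists phi : {ffun L -> option W}, forall T, exists Z,
    [/\ phi T = Some Z, Z \in opts T &
        forall T' Z', T' != T -> phi T' = Some Z' -> ~~ conf T Z T' Z'].
Proof.
suff /card_gt0P[phi] : 0 < #|partial_transversals [set: L]|.
  rewrite inE => /andP[/forallP h1 /forallP h2]; exists phi => T.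
  move: (h1 T); case E: (phi T) => [Z|]; last by rewrite inE.
  rewrite inE /= => ZT; exists Z; split=> // T' Z' TT' E'.
  by move/forallP/(_ T'): (h2 T); rewrite eq_sym TT' E E'.
have : forall n (A : {set L}), #|A| = n -> 0 < #|partial_transversals A|.
  elim=> [|n IH] A.
    move/eqP; rewrite cards_eq0 => /eqP->; apply/card_gt0P; exists [ffun=> None].
    rewrite inE; apply/andP; split; apply/forallP => T; rewrite ?ffunE ?inE //.
    by apply/forallP => T'; rewrite implybT.
  move=> An; have /card_gt0P[T TA] : 0 < #|A| by rewrite An.
  have An' : #|A :\ T| = n by move: An; rewrite (cardsD1 T) TA => -[].
  have := @transversal_growth n (A :\ T) T; rewrite An' leqnn !inE eqxx setD1K //.
  by move/(_ isT isT); have := IH _ An'; rewrite -(ltn_pmul2l N_gt0); lia.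
by apply.
Qed.

End IndependentTransversal.

(** * Completing a packing whose uncovered sets are thin *)

Section Extensions.

Variables (V : finType) (t e : nat) (L : {set {set V}}).
Hypothesis L_card : forall T, T \in L -> #|T| = t.
Hypothesis L_deg : forall S : {set V}, #|S|.+1 = t ->
  e * #|[set y | (y \notin S) && (y |: S \in L)]| <= #|V|.

(** When all points of [I :|: f @: A] but one are fixed, they form a [(t-1)]-set
and the thinness of [L] above it leaves few values for the last one. *)
Lemma card_random_hit (J : finType) (A : {set J}) (I : {set V}) :
  A != set0 -> #|I| + #|A| = t ->
  e * #|[set f : {ffun J -> V} | I :|: f @: A \in L]| <= #|V| ^ #|J|.
Proof.
case/set0Pn => a aA cIA; apply: (@leq_card_ffun_fibers _ _ a) => f.
pose S := I :|: f @: (A :\ a).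
have upd y : I :|: fupd f a y @: A = y |: S.
  rewrite -{1}(setD1K aA) imsetU1 ffunE eqxx setUCA; congr (_ |: (_ :|: _)).
  apply: eq_in_imset => x; rewrite !inE ffunE => /andP[/negbTE-> _] //.
have St : #|S| < t.
  apply: leq_ltn_trans (leq_card_setU _ _) _; rewrite -cIA (cardsD1 a A) aA ltn_add2l.
  by rewrite add1n ltnS leq_imset_card.
have Sy y : y |: S \in L -> (y \notin S) /\ #|S|.+1 = t.
  move=> h; have := L_card h; rewrite cardsU1.
  by case: (y \notin S) => /=; rewrite ?add1n // add0n => E; rewrite E ltnn in St.
have [Et|Nt] := eqVneq #|S|.+1 t.
  apply: leq_trans (L_deg Et); rewrite leq_mul2l; apply/orP; right.
  apply: subset_leq_card; apply/subsetP => y h; have {}h : y |: S \in L by rewrite -upd; move: h; rewrite !in_set.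
  by rewrite in_set h andbT; case: (Sy _ h).
rewrite (_ : [set y | _] = set0) ?cards0 ?muln0 //.
apply/setP => y; rewrite !inE upd; apply/negP => /Sy[_ E].
by rewrite E eqxx in Nt.
Qed.

Lemma card_thin_above (I : {set V}) j : 0 < j -> #|I| + j = t ->
  e * #|[set T in L | I \subset T]| <= #|V| ^ j.
Proof.
move=> j0 cI; have := @card_random_hit 'I_j [set: 'I_j] I.
rewrite -card_gt0 cardsT card_ord => /(_ j0 cI) h; apply: leq_trans h.
rewrite leq_mul2l; apply/orP; right.
apply: leq_trans (leq_imset_card (fun f : {ffun 'I_j -> V} => I :|: f @: [set: 'I_j]) _).
apply: subset_leq_card; apply/subsetP => T; rewrite inE => /andP[TL IT].
have cD : #|T :\: I| = j.
  by rewrite cardsD (setIidPr IT) (L_card TL) -cI addKn.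
have E : I :|: [ffun i => enum_val (cast_ord (esym cD) i)] @: [set: 'I_j] = T.
  transitivity (I :|: T :\: I); last by rewrite -{1}(setIidPr IT) setID.
  congr (_ :|: _); apply/setP => x; apply/imsetP/idP => [[i _ ->]|xD].
    by rewrite ffunE; apply: enum_valP.
  exists (cast_ord cD (enum_rank_in xD x)) => //.
  by rewrite ffunE cast_ordK enum_rankK_in.
by apply/imsetP; exists [ffun i => enum_val (cast_ord (esym cD) i)]; rewrite ?inE E.
Qed.

End Extensions.

Section Completions.

Variables (V : finType) (t s e : nat) (L : {set {set V}}).
Hypothesis L_card : forall T, T \in L -> #|T| = t.
Hypothesis L_deg : forall S : {set V}, #|S|.+1 = t ->
  e * #|[set y | (y \notin S) && (y |: S \in L)]| <= #|V|.

Definition block_of (T : {set V}) (f : {ffun 'I_s -> V}) : {set V} :=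
  T :|: f @: [set: 'I_s].

(** The extensions are functions rather than sets, so that the choice of the new
points is a product choice. *)
Definition completions (T : {set V}) : {set {ffun 'I_s -> V}} :=
  [set f | (#|block_of T f| == t + s) &&
           [forall U in L, (U \subset block_of T f) ==> (U == T)]].

Lemma card_collide (a b : 'I_s) : a != b ->
  #|V| * #|[set f : {ffun 'I_s -> V} | f a == f b]| <= #|V| ^ s.
Proof.
move=> ab; rewrite -[X in _ <= _ ^ X](card_ord s); apply: (leq_card_ffun_fibers (a := b)) => f.
rewrite -[leqRHS]muln1 leq_mul2l -(cards1 (f a)); apply/orP; right.
apply/subset_leq_card/subsetP => y; rewrite in_set in_set !ffunE eqxx (negbTE ab).
by rewrite in_set1 eq_sym.
Qed.

Lemma card_hit (a : 'I_s) x :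
  #|V| * #|[set f : {ffun 'I_s -> V} | f a == x]| <= #|V| ^ s.
Proof.
rewrite -[X in _ <= _ ^ X](card_ord s); apply: (leq_card_ffun_fibers (a := a)) => f.
rewrite -[leqRHS]muln1 leq_mul2l -(cards1 x); apply/orP; right.
apply/subset_leq_card/subsetP => y; rewrite in_set in_set !ffunE eqxx.
by rewrite in_set1.
Qed.

(** A subset of a block is recorded by its trace on [T] and by the indices of its
new points; the union bounds below range over these finitely many patterns. *)
Lemma decompose_subset (T U : {set V}) (f : {ffun 'I_s -> V}) :
  U \subset block_of T f ->
  U = (U :&: T) :|: f @: [set a | f a \in U :\: T].
Proof.
move=> /subsetP UF; apply/setP => x; apply/idP/setUP => [xU|[/setIP[]//|]].
  have [xT|xT] := boolP (x \in T); first by left; rewrite inE xU.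
  right; have := UF _ xU; rewrite inE (negbTE xT) => /imsetP[a _ Ex].
  by apply/imsetP; exists a; rewrite ?inE -?Ex ?xT.
by case/imsetP => a; rewrite !inE => /andP[_ h] ->.
Qed.

Lemma card_decompose (T U : {set V}) (f : {ffun 'I_s -> V}) :
  #|block_of T f| = #|T| + s -> U \subset block_of T f ->
  #|U :&: T| + #|[set a | f a \in U :\: T]| = #|U|.
Proof.
move=> cF UF.
have finj : injective f.
  suff /imset_injP h : #|f @: [set: 'I_s]| == #|[set: 'I_s]|.
    by move=> a b; apply: h; rewrite inE.
  rewrite eqn_leq leq_imset_card cardsT card_ord.
  by have := (leq_card_setU T (f @: [set: 'I_s])).1; rewrite -/(block_of T f) cF leq_add2l.
rewrite -(card_imset _ finj) -(cardsID T U); congr (_ + _).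
apply: eq_card => x; apply/imsetP/idP => [[a + ->]|]; first by rewrite inE.
move=> xUT; have [xU xT] := setDP xUT.
have := subsetP UF _ xU; rewrite inE (negbTE xT) => /imsetP[a _ Ex].
by exists a; rewrite ?inE -?Ex ?xU ?xT.
Qed.

(** An extension fails if two new points coincide, if a new point falls into [T],
or if a second member of [L] appears; the last has to use a new point, and
[card_random_hit] applies to it. *)
Lemma card_not_completions T : T \in L ->
  e * #|V| * #|~: completions T| <=
    (s * s + s * t) * e * #|V| ^ s + 2 ^ (t + s) * #|V| * #|V| ^ s.
Proof.
move=> TL; have cT := L_card TL.
pose B1 := \bigcup_(p in [set p : 'I_s * 'I_s | p.1 != p.2])
  [set f : {ffun 'I_s -> V} | f p.1 == f p.2].
pose B2 := \bigcup_(p in setX [set: 'I_s] T)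
  [set f : {ffun 'I_s -> V} | f p.1 == p.2].
pose P3 := [set p : {set V} * {set 'I_s} |
  [&& p.1 \subset T, p.2 != set0 & #|p.1| + #|p.2| == t]].
pose B3 := \bigcup_(p in P3) [set f : {ffun 'I_s -> V} | p.1 :|: f @: p.2 \in L].
have cB1 : #|V| * #|B1| <= s * s * #|V| ^ s.
  apply: (@leq_trans (#|[set p : 'I_s * 'I_s | p.1 != p.2]| * #|V| ^ s)).
    by apply: card_bigcup_bound => p; rewrite inE; apply: card_collide.
  rewrite leq_mul2r; apply/orP; right; apply: leq_trans (max_card _) _.
  by rewrite card_prod card_ord.
have cB2 : #|V| * #|B2| <= s * t * #|V| ^ s.
  apply: (@leq_trans (#|setX [set: 'I_s] T| * #|V| ^ s)).
    by apply: card_bigcup_bound => p _; apply: card_hit.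
  by rewrite cardsX cardsT card_ord cT.
have cB3 : e * #|B3| <= 2 ^ (t + s) * #|V| ^ s.
  apply: (@leq_trans (#|P3| * #|V| ^ s)).
    apply: card_bigcup_bound => p; rewrite inE => /and3P[_ p0 /eqP cp].
    by rewrite -[X in _ <= _ ^ X](card_ord s); apply: (card_random_hit L_card L_deg p0 cp).
  rewrite leq_mul2r; apply/orP; right.
  apply: (@leq_trans #|setX (powerset T) (powerset [set: 'I_s])|).
    apply: subset_leq_card; apply/subsetP => p; rewrite !inE => /and3P[-> _ _].
    exact: subsetT.
  by rewrite cardsX !card_powerset cardsT card_ord cT expnD.
have sub : ~: completions T \subset B1 :|: B2 :|: B3.
  apply/subsetP => f; rewrite inE => fT.
  have [finj|] := boolP [forall a, forall b, (f a == f b) ==> (a == b)]; last first.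
    move=> /forallPn[a /forallPn[b]]; rewrite negb_imply => /andP[ab nab].
    by apply/setUP; left; apply/setUP; left; apply/bigcupP; exists (a, b); rewrite !inE.
  have [fT'|] := boolP [forall a, f a \notin T]; last first.
    move=> /forallPn[a]; rewrite negbK => aT.
    apply/setUP; left; apply/setUP; right; apply/bigcupP; exists (a, f a); rewrite !inE //=.
  apply/setUP; right; rewrite inE in fT.
  have cF : #|block_of T f| = t + s.
    rewrite /block_of cardsU cT (_ : T :&: _ = set0).
      rewrite cards0 subn0 card_imset ?cardsT ?card_ord //.
      by move=> a b /eqP E; apply/eqP; move/forallP/(_ a)/forallP/(_ b)/implyP: finj; apply.
    apply/setP => x; rewrite !inE; apply/negP => /andP[xT /imsetP[a _ Ex]].
    by move/forallP/(_ a): fT'; rewrite -Ex xT.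
  move: fT; rewrite cF eqxx /= => /forall_inPn[U UL]; rewrite negb_imply => /andP[UF UT].
  apply/bigcupP; exists (U :&: T, [set a | f a \in U :\: T]); last first.
    by rewrite inE /= -decompose_subset.
  rewrite inE /= subsetIr card_decompose ?cT // (L_card UL) eqxx andbT /=.
  apply: contraNneq UT => E; rewrite eqEcard cT (L_card UL) leqnn andbT.
  by rewrite (decompose_subset UF) E imset0 setU0 subsetIr.
have := subset_leq_card sub.
have := (leq_card_setU (B1 :|: B2) B3).1; have := (leq_card_setU B1 B2).1.
move: #|_ :|: B3| #|B1 :|: B2| #|~: _| cB1 cB2 cB3; move: #|B1| #|B2| #|B3| => b1 b2 b3 u v c.
move: (#|V| ^ s) #|V| (2 ^ (t + s)) => vs v0 w h1 h2 h3 h4 h5 h6.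
have : e * v0 * c <= e * (v0 * b1 + v0 * b2) + v0 * (e * b3).
  have -> : e * (v0 * b1 + v0 * b2) + v0 * (e * b3) = e * v0 * (b1 + b2 + b3) by lia.
  by rewrite leq_mul2l; apply/orP; right; lia.
move=> /leq_trans; apply; apply: leq_add.
  by rewrite -mulnA [in leqRHS](mulnCA _ e) leq_mul2l mulnDl leq_add ?orbT.
by rewrite -mulnA [in leqRHS]mulnCA leq_mul2l h3 orbT.
Qed.

Definition conflict (T : {set V}) (f : {ffun 'I_s -> V}) T' f' :=
  t <= #|block_of T f :&: block_of T' f'|.

(** A conflict produces a [t]-set [U] inside both blocks.  As [T] is the only
member of [L] in its own block, [U] differs from [T'] and uses at least one new
point of the block of [T'].  Thinness bounds the choices of [T'] above
[U :&: T'], and the new points in [U] have at most [t] values each. *)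
Lemma card_conflicts T f : 0 < #|V| -> T \in L -> f \in completions T ->
  e * #|[set p : {set V} * {ffun 'I_s -> V} |
     [&& p.1 \in L, p.1 != T, p.2 \in completions p.1 & conflict T f p.1 p.2]]| <=
  2 ^ (t + s) * 2 ^ (t + s) * 2 ^ s * (t.+1 ^ s * #|V| ^ s).
Proof.
move=> V0 TL; rewrite inE => /andP[/eqP cF /forall_inP FL].
set F := block_of T f in cF FL *.
pose P := [set p : {set V} * {set V} * {set 'I_s} |
  [&& p.1.1 \subset F, #|p.1.1| == t, p.1.2 \subset p.1.1, p.2 != set0 &
      #|p.1.2| + #|p.2| == t]].
pose Y (p : {set V} * {set V} * {set 'I_s}) :=
  setX [set T' in L | p.1.2 \subset T'] [set f' : {ffun 'I_s -> V} | f' @: p.2 \subset p.1.1].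
apply: (@leq_trans (e * #|\bigcup_(p in P) Y p|)).
  rewrite leq_mul2l; apply/orP; right; apply: subset_leq_card.
  apply/subsetP => -[T' f']; rewrite !inE /= => /and4P[T'L TT' /andP[/eqP cF' /forall_inP F'L]].
  rewrite /conflict -/F => /card_geqP[u [uu su uF]].
  have [U [cU UF UF']] : exists U : {set V}, [/\ #|U| = t, U \subset F & U \subset block_of T' f'].
    exists [set x in u]; split; first by rewrite cardsE (card_uniqP uu) su.
      by apply/subsetP => x; rewrite inE => /uF /setIP[].
    by apply/subsetP => x; rewrite inE => /uF /setIP[].
  apply/bigcupP; exists (U, U :&: T', [set a | f' a \in U :\: T']); last first.
    rewrite !inE /= T'L subsetIr /=.
    by apply/subsetP => x /imsetP[a]; rewrite !inE => /andP[_ h] ->.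
  rewrite inE /= UF cU eqxx subsetIl /= (card_decompose _ UF') ?(L_card T'L) // cU eqxx andbT.
  apply: contraNneq TT' => E; apply: (implyP (FL _ T'L)).
  suff -> : T' = U by [].
  apply/esym/eqP; rewrite eqEcard cU (L_card T'L) leqnn andbT.
  by rewrite (decompose_subset UF') E imset0 setU0 subsetIr.
apply: leq_trans (card_bigcup_bound (d := t.+1 ^ s * #|V| ^ s) _) _.
  move=> [[U I] A]; rewrite inE /= => /and5P[_ /eqP cU _ A0 /eqP cIA].
  rewrite /Y cardsX /=; have A0' : 0 < #|A| by rewrite card_gt0.
  have h1 := card_thin_above L_card L_deg A0' cIA.
  have h2 := card_ffun_into A U; rewrite card_ord cU in h2.
  suff : #|V| ^ #|A| * (e * (#|[set T' in L | I \subset T']| *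
      #|[set f' : {ffun 'I_s -> V} | f' @: A \subset U]|)) <=
      #|V| ^ #|A| * (t.+1 ^ s * #|V| ^ s).
    by rewrite leq_pmul2l // expn_gt0 V0.
  have h3 : t ^ #|A| <= t.+1 ^ s.
    apply: (@leq_trans (t.+1 ^ #|A|)); first by rewrite leq_exp2r.
    by rewrite leq_pexp2l // -[X in _ <= X]card_ord max_card.
  have := leq_mul h1 h2; have := leq_mul h3 (leqnn (#|V| ^ s)).
  have := leq_mul (leqnn (#|V| ^ #|A|)) (leq_mul h3 (leqnn (#|V| ^ s))).
  move: #|[set T' in L | _]| #|[set f' : {ffun 'I_s -> V} | _]| => a b.
  move: (#|V| ^ #|A|) (#|V| ^ s) (t ^ _) (t.+1 ^ s) => x y z w; lia.
rewrite leq_mul2r; apply/orP; right.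
apply: (@leq_trans #|setX (setX (powerset F) (powerset F)) (powerset [set: 'I_s])|).
  apply: subset_leq_card; apply/subsetP => p; rewrite !inE => /and5P[h _ h' _ _].
  by rewrite h (subset_trans h' h) subsetT.
by rewrite !cardsX !card_powerset cardsT card_ord cF.
Qed.

End Completions.

(** The extensions of the uncovered sets are the options of an independent
transversal problem; at least half of all extensions are admissible, and
conflicts are rarer by the factor [1/e]. *)
Lemma augment_packing (t k : nat) : 0 < t -> t < k ->
  exists e n1 : nat, forall (V : finType) (Q : {set {set V}}), n1 <= #|V| ->
    packing t k Q ->
    (forall S : {set V}, #|S|.+1 = t ->
      e * #|[set y | (y \notin S) && (y |: S \in uncovered t Q)]| <= #|V|) ->
  exists F : {set {set V}}, uniform_hypergraph k F /\
    forall A : {set V}, #|A| = t -> codegree F A \in pred2 1 2.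
Proof.
move=> t0 tk; pose s := k - t; have ks : k = t + s by rewrite subnKC // ltnW.
have s0 : 0 < s by rewrite subn_gt0.
(* [c] dominates the constants of both union bounds. *)
pose c := 2 ^ (t + s) * 2 ^ (t + s) * 2 ^ s * t.+1 ^ s + 2 ^ (t + s).
exists (16 * c), (16 + 4 * (s * s + s * t)) => V Q nV [Qk Qt] deg.
set L := uncovered t Q in deg *.
have L_card T : T \in L -> #|T| = t by rewrite inE => /andP[/eqP].
have V0 : 0 < #|V| by apply: leq_trans nV.
have nVs : 16 <= #|V| ^ s.
  by rewrite -(prednK s0) expnS (leq_trans (_ : 16 <= #|V|)) ?leq_pmulr ?expn_gt0 ?V0 //; lia.
have c0 : 0 < c by rewrite addn_gt0 !expn_gt0 orbT.
(* With [N] about half the number of all extensions, a set of options of size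
   [N] is available and each option has at most [N / 4] conflicts. *)
pose LT := {T : {set V} | T \in L}.
pose opts (T : LT) := @completions V t s L (val T).
pose conf (T : LT) (f : {ffun 'I_s -> V}) (T' : LT) f' := conflict t (val T) f (val T') f'.
have hopts T : (#|V| ^ s)./2 <= #|opts T|.
  have := @card_not_completions V t s _ L L_card deg _ (valP T).
  rewrite -/(opts T); have := cardsC (opts T); rewrite card_ffun card_ord.
  move: #|opts T| #|~: opts T| => a b <- h.
  suff : 2 * b <= a + b by lia.
  have h1 : 4 * (s * s + s * t) * (4 * c * (a + b)) <= #|V| * (4 * c * (a + b)).
    by rewrite leq_mul2r; apply/orP; right; lia.
  have h2 : 2 ^ (t + s) * (#|V| * (a + b)) <= c * (#|V| * (a + b)).
    by rewrite leq_mul2r; apply/orP; right; rewrite leq_addl.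
  suff : 8 * c * #|V| * (2 * b) <= 8 * c * #|V| * (a + b).
    by rewrite leq_pmul2l // !muln_gt0 c0.
  by move: h h1 h2; rewrite !mulnDr; lia.
have hdeg T f : f \in opts T -> 4 * #|[set p : LT * {ffun 'I_s -> V} |
    [&& p.1 != T, p.2 \in opts p.1 & conf T f p.1 p.2]]| <= (#|V| ^ s)./2.
  move=> fT; have := card_conflicts L_card deg V0 (valP T) fT.
  set X := [set p : _ * _ | _]; set Y := [set p : LT * _ | _].
  have YX : #|Y| <= #|X|.
    rewrite -(card_imset (f := fun p : LT * {ffun 'I_s -> V} => (val p.1, p.2))); last first.
      by move=> [T1 f1] [T2 f2] [/val_inj -> ->].
    apply/subset_leq_card/subsetP => _ /imsetP[[T' f'] hY ->]; move: hY; rewrite in_set /=.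
    by move=> /and3P[TT' h cf]; rewrite in_set /= (valP T') h TT'.
  move: YX; move: #|X| #|Y| => x y yx h.
  have : c * (16 * x) <= c * (#|V| ^ s).
    rewrite mulnA (mulnC c); apply: leq_trans h _.
    by rewrite mulnA leq_mul2r leq_addr orbT.
  by rewrite leq_pmul2l //; lia.
have N0 : 0 < (#|V| ^ s)./2 by lia.
have csym T f T' f' : conf T f T' f' = conf T' f' T f.
  by rewrite /conf /conflict setIC.
have [phi hphi] := independent_transversal N0 csym hopts hdeg.
pose new := [set K : {set V} | [exists T : LT, exists f,
  (phi T == Some f) && (K == block_of (val T) f)]].
have newP K : reflect (exists T f, phi T = Some f /\ K = block_of (val T) f) (K \in new).
  rewrite inE; apply: (iffP existsP) => [[T /existsP[f /andP[/eqP h1 /eqP h2]]]|[T [f [h1 h2]]]].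
    by exists T, f.
  by exists T; apply/existsP; exists f; rewrite h1 h2 !eqxx.
have block_ok T f : phi T = Some f ->
    #|block_of (val T) f| = k /\
    forall U, U \in L -> U \subset block_of (val T) f -> U = val T.
  move=> E; have [f' []] := hphi T; rewrite E => -[<-]; rewrite inE => /andP[/eqP -> /forall_inP h] _.
  split=> // U UL Uf; apply/eqP; exact: (implyP (h U UL)).
have new_unique (A K K' : {set V}) : #|A| = t -> K \in new -> K' \in new -> A \subset K ->
    A \subset K' -> K = K'.
  move=> cA /newP[T [f [E ->]]] /newP[T' [f' [E' ->]]] AK AK'.
  have [TT'|TT'] := eqVneq T' T; first by move: E'; rewrite TT' E => -[->].
  have [f1 []] := hphi T; rewrite E => -[<-] _ /(_ _ _ TT' E') /negP[].
  have : #|A| <= #|block_of (val T) f :&: block_of (val T') f'|.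
    by apply: subset_leq_card; rewrite subsetI AK.
  by rewrite cA.
exists (Q :|: new); split=> [K /setUP[/Qk //|/newP[T [f [/block_ok[cB _] ->]]] //]|A cA].
have [AL|AL] := boolP (A \in L).
  have [f [E _ _]] := hphi (exist _ A AL).
  rewrite /codegree (_ : [set _ in _ | _] = [set block_of A f]) ?cards1 //.
  apply/setP => K; rewrite in_set1; apply/idP/eqP => [|->].
    rewrite inE => /andP[/setUP[KQ|/newP[T [f' [E' ->]]]] AK].
      by have := AL; rewrite inE cA eqxx => /exists_inPn/(_ K KQ); rewrite AK.
    have [_ /(_ A AL AK) AT] := block_ok _ _ E'.
    have TA : T = exist _ A AL by apply: val_inj.
    by move: E'; rewrite TA E => -[->].
  rewrite inE subsetUl andbT; apply/setUP; right; apply/newP.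
  by exists (exist _ A AL), f.
have /exists_inP[K KQ AK] : [exists K in Q, A \subset K].
  by move: AL; rewrite inE cA eqxx negbK.
have cQ : #|[set e in Q | A \subset e]| = 1.
  rewrite (_ : [set _ in _ | _] = [set K]) ?cards1 //; apply/setP => K'.
  rewrite in_set1 inE; apply/andP/eqP => [[K'Q AK']|-> //].
  by apply: Qt => //; rewrite -cA subset_leq_card // subsetI AK'.
have cnew : #|[set e in new | A \subset e]| <= 1.
  rewrite leqNgt; apply/negP => /card_gt1P[K1 [K2 []]].
  rewrite !in_set => /andP[h1 h2] /andP[h3 h4] /eqP[].
  by apply: (new_unique A) => //; rewrite inE.
have -> : codegree (Q :|: new) A = #|[set e in Q | A \subset e] :|: [set e in new | A \subset e]|.
  by apply: eq_card => K'; rewrite !inE andb_orl.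
have := (leq_card_setU [set e in Q | A \subset e] [set e in new | A \subset e]).1.
have := subset_leq_card (subsetUl [set e in Q | A \subset e] [set e in new | A \subset e]).
rewrite cQ; move: cnew; move: #|[set e in new | _]| #|_ :|: _| => a d a1 d1 da.
have [->|->] : d = 1 \/ d = 2 by lia.
- by rewrite inE.
- by rewrite inE.
Qed.

(** * Codes with prescribed functionals, and the packings they give *)

Section LinearAlgebra.
Import GRing.Theory.
Local Open Scope ring_scope.

(** Newton's form: a node is added with a multiple of the polynomial that vanishes
at the earlier nodes. *)
Lemma interpolation (F : fieldType) (I : eqType) (s : seq I) (x c : I -> F) :
  uniq (map x s) ->
  exists2 p : {poly F}, (size p <= size s)%N & forall i, i \in s -> p.[x i] = c i.
Proof.
elim: s => [|i s IH] /=; first by exists 0; rewrite ?size_poly0.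
case/andP => xi us; have [p sp ps] := IH us.
pose N := \prod_(j <- s) ('X - (x j)%:P).
have sN : size N = (size s).+1 by rewrite size_prod_XsubC.
have Ni : N.[x i] != 0.
  rewrite horner_prod prodf_seq_neq0; apply/allP => j js /=.
  by rewrite hornerXsubC subr_eq0; apply: contraNneq xi => ->; apply: map_f.
exists (p + ((c i - p.[x i]) / N.[x i])%:P * N) => [|j].
  apply: leq_trans (size_polyD _ _) _; rewrite geq_max (leq_trans sp) //.
  by rewrite mul_polyC (leq_trans (size_scale_leq _ _)) ?sN.
rewrite inE => /predU1P[->|js]; rewrite !hornerE.
  by rewrite divfK // addrC subrK.
rewrite (ps _ js) [N.[x j]](_ : _ = 0) ?mulr0 ?addr0 //.
rewrite horner_prod; apply/eqP; rewrite prodf_seq_eq0; apply/hasP; exists j => //.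
by rewrite /= hornerXsubC subrr.
Qed.

(** As long as [C] is too small, the spaces [C + Z i] are proper subspaces of [H]
and there are fewer than [#|F|] of them, so they do not fill [H]; any vector
outside all of them can be added to [C]. *)
Lemma common_complement (F : finFieldType) (m n : nat) (I : finType)
    (H : {vspace 'M[F]_(m, n)}) (Z : I -> {vspace 'M[F]_(m, n)}) (i0 : I) (d : nat) :
  (#|I| < #|F|)%N -> (forall i, (Z i <= H)%VS) ->
  (forall i, (d + \dim (Z i) <= \dim H)%N) ->
  exists C : {vspace 'M[F]_(m, n)},
    [/\ (C <= H)%VS, \dim C = d & forall i, (C :&: Z i)%VS = 0%VS].
Proof.
move=> IF ZH; elim: d => [|d IH] dH.
  by exists 0%VS; split=> [||i]; rewrite ?sub0v ?dimv0 ?cap0v.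
have [i|C [CH dC CZ]] := IH; first by apply: leq_trans (dH i); rewrite leq_add2r.
have dCZ i : \dim (C + Z i) = (d + \dim (Z i))%N.
  by rewrite dimv_disjoint_sum ?CZ ?dC.
have q1 : (1 < #|F|)%N := finNzRing_gt1 F.
have [v vH vCZ] : exists2 v, v \in H & forall i, v \notin (C + Z i)%VS.
  have : (#|\bigcup_(i in [set: I]) [set v in (C + Z i)%VS]| < #|[set v in H]|)%N.
    rewrite -(@ltn_pmul2l #|F|) ?(ltnW q1) //.
    apply: leq_ltn_trans (card_bigcup_bound (d := (#|F| ^ \dim H)%N) _) _.
      move=> i _; rewrite cardsE card_vspace -expnS leq_exp2l // dCZ.
      exact: dH.
    rewrite cardsT cardsE card_vspace ltn_mul2r IF expn_gt0.
    by rewrite (ltnW q1).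
  rewrite ltnNge => /negP h.
  have /subsetPn[v] : ~~ ([set v in H] \subset \bigcup_(i in [set: I]) [set v in (C + Z i)%VS]).
    by apply/negP => /subset_leq_card.
  rewrite inE => vH vn; exists v => // i; apply: contra vn => h'.
  by apply/bigcupP; exists i; rewrite ?inE.
have Cv : (C :&: <[v]> = 0)%VS.
  apply/eqP; rewrite -subv0; apply/subvP => u /memv_capP[uC /vlineP[a ua]].
  rewrite memv0 ua scaler_eq0; apply/orP; left; apply: contraNT (vCZ i0) => a0.
  apply: (subvP (addvSl _ _)); rewrite -[v]scale1r -(mulVf a0) -scalerA -ua.
  exact: memvZ.
have v0 : v != 0.
  by apply: contraNneq (vCZ i0) => ->; apply: mem0v.
exists (C + <[v]>)%VS; split.
- by rewrite subv_add CH -memvE.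
- by rewrite dimv_disjoint_sum // dC dim_vline v0 addn1.
move=> i; apply/eqP; rewrite -subv0; apply/subvP => u /memv_capP[/memv_addP[w wC [_ /vlineP[a ->] uE]] uZ].
have [a0|a0] := eqVneq a 0.
  by rewrite -(CZ i); apply/memv_capP; rewrite uE a0 scale0r addr0 in uZ *.
case/negP: (vCZ i); rewrite -[v]scale1r -(mulVf a0) -scalerA; apply: memvZ.
have -> : a *: v = - w + u by rewrite uE addKr.
by apply: memv_add; rewrite ?memvN.
Qed.

Section Codes.

Variables (F : finFieldType) (M d : nat) (alpha : {set 'I_M} -> F).
Implicit Types (x : 'M[F]_(M, d)) (A B K T : {set 'I_M}).

Definition mask A x : 'M[F]_(M, d) := \matrix_(i, l) (if i \in A then x i l else 0).

Fact mask_is_linear A : linear (mask A).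
Proof. by move=> a x y; apply/matrixP => i l; rewrite !mxE; case: ifP; rewrite // mulr0 addr0. Qed.

HB.instance Definition _ A := GRing.isLinear.Build F _ _ _ (mask A) (mask_is_linear A).

(** The matrices supported on the rows in [A]; row [i] is the entry of the word at
copy [i]. *)
Definition words A : {vspace 'M[F]_(M, d)} := limg (linfun (mask A)).

Lemma wordsP A x : reflect (forall i, i \notin A -> row i x = 0) (x \in words A).
Proof.
apply: (iffP memv_imgP) => [[y _ ->] i iA|h].
  by apply/rowP => l; rewrite lfunE !mxE (negbTE iA).
exists x; rewrite ?memvf // lfunE; apply/matrixP => i l; rewrite !mxE; case: ifPn => // iA.
by move/rowP/(_ l): (h _ iA); rewrite !mxE.
Qed.

Lemma words_mono A B : A \subset B -> (words A <= words B)%VS.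
Proof.
move=> AB; apply/subvP => x /wordsP h; apply/wordsP => i iB; apply: h.
by apply: contra iB; apply: (subsetP AB).
Qed.

Lemma dim_words A : \dim (words A) = (#|A| * d)%N.
Proof.
have q1 : (1 < #|F|)%N := finNzRing_gt1 F.
apply: (expnI q1); rewrite -card_vspace.
pose rows x : {ffun 'I_M -> 'rV[F]_d} := [ffun i => row i x].
have rinj : injective rows.
  by move=> x y /ffunP E; apply/row_matrixP => i; have := E i; rewrite !ffunE.
pose P (i : 'I_M) : pred 'rV[F]_d := [pred y | (i \in A) || (y == 0)].
rewrite -(card_imset _ rinj).
have -> : #|[set rows x | x in words A]| = #|(family P : simpl_pred {ffun 'I_M -> 'rV[F]_d})|.
  apply: eq_card => g; apply/imsetP/familyP => [[x /wordsP h ->] i|h].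
    by rewrite inE ffunE; case: (boolP (i \in A)) => //= iA; rewrite h.
  exists (\matrix_i g i); last by apply/ffunP => i; rewrite ffunE rowK.
  by apply/wordsP => i iA; rewrite rowK; have := h i; rewrite inE (negbTE iA) => /eqP.
rewrite card_family foldrE big_map big_enum /= (bigID (mem A)) /=.
rewrite [X in (_ * X)%N]big1 => [|i iA]; last first.
  transitivity #|pred1 (0 : 'rV[F]_d)|; last exact: card1.
  by apply: eq_card => y; rewrite !inE (negbTE iA).
rewrite muln1 mulnC expnM -prod_nat_const.
have cV : #|'rV[F]_d| = (#|F| ^ d)%N by rewrite card_mx mul1n.
rewrite -cV; apply: eq_bigr => i iA; apply: eq_card => y.
by rewrite !inE iA.
Qed.

(** Row [i] is read as a polynomial of degree less than [d], which is evaluated at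
the node attached to [T].  Distinct nodes make the functionals of different [T]
independent on every single row. *)
Definition functional T x : F := \sum_(i in T) \sum_(l < d) x i l * alpha T ^+ l.

Fact functional_is_scalar T : linear_for *%R (functional T).
Proof.
move=> a x y; rewrite /functional mulr_sumr -big_split; apply: eq_bigr => i _ /=.
rewrite mulr_sumr -big_split; apply: eq_bigr => l _ /=; rewrite !mxE; ring.
Qed.

HB.instance Definition _ T := GRing.isLinear.Build F _ _ _ (functional T) (functional_is_scalar T).

Hypothesis alpha_inj : injective alpha.

(** Every [T] in [TT] chooses a row in [T :&: B] that carries the value [c T] for
it; each row is then a polynomial with prescribed values at no more than [d]
nodes. *)
Lemma solve_functionals (TT : {set {set 'I_M}}) B (c : {set 'I_M} -> F) :
  (#|TT| <= d)%N -> (forall T, T \in TT -> T :&: B != set0) ->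
  exists2 x, x \in words B & forall T, T \in TT -> functional T x = c T.
Proof.
move=> cTT TB.
have [g gP] : exists g : {set 'I_M} -> option 'I_M,
    forall T, T \in TT -> exists i, [/\ g T = Some i, i \in T & i \in B].
  exists (fun T => [pick i in T :&: B]) => T /TB /set0Pn[i iTB].
  case: pickP => [j|/(_ i)]; last by rewrite iTB.
  by rewrite inE => /andP[jT jB]; exists j.
have us : uniq (map alpha (enum TT)) by rewrite map_inj_uniq ?enum_uniq.
have P (i : 'I_M) := interpolation (fun T => if g T == Some i then c T else 0) us.
have [p sp' pE'] := fin_all_exists2 P.
have sp i : (size (p i) <= d)%N by apply: leq_trans cTT; rewrite cardE; apply: sp'.
have pE i T : T \in TT -> (p i).[alpha T] = if g T == Some i then c T else 0.
  by move=> TTT; rewrite pE' // mem_enum.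
exists (mask B (\matrix_(i, l) (p i)`_l)).
  by apply/wordsP => i iB; apply/rowP => l; rewrite !mxE (negbTE iB).
move=> T TTT; have [i0 [gT iT iB]] := gP _ TTT.
rewrite /functional (bigD1 i0) //= [X in _ + X]big1 => [|i /andP[_ ii0]].
  rewrite addr0; transitivity (p i0).[alpha T]; last by rewrite pE // gT eqxx.
  by rewrite (horner_coef_wide _ (sp i0)); apply: eq_bigr => l _; rewrite !mxE iB.
have [iB'|iB'] := boolP (i \in B); last first.
  by rewrite big1 // => l _; rewrite !mxE (negbTE iB') mul0r.
transitivity (p i).[alpha T].
  by rewrite (horner_coef_wide _ (sp i)); apply: eq_bigr => l _; rewrite !mxE iB'.
rewrite pE // gT; case: eqP => // -[E].
by rewrite E eqxx in ii0.
Qed.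

Definition subsets_of_size t K : {set {set 'I_M}} := [set T : {set 'I_M} | T \subset K & #|T| == t].

(** All functionals of [t]-subsets of [K] at once; its kernel is where the code
lives. *)
Definition evaluation t K x : {ffun {set 'I_M} -> F^o} :=
  [ffun T => if T \in subsets_of_size t K then functional T x else 0].

Fact evaluation_is_linear t K : linear (evaluation t K).
Proof.
move=> a x y; apply/ffunP => T; rewrite !ffunE; case: ifP => _; rewrite ?scaler0 ?addr0 //.
by rewrite linearP.
Qed.

HB.instance Definition _ t K :=
  GRing.isLinear.Build F _ _ _ (evaluation t K) (evaluation_is_linear t K).

Lemma card_subsets_of_size t K : (2 ^ #|K| <= d)%N -> (#|subsets_of_size t K| <= d)%N.
Proof.
apply: leq_trans; rewrite -card_powerset; apply: subset_leq_card.
by apply/subsetP => T; rewrite !inE => /andP[].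
Qed.

(** The code is a common complement, in the kernel of [evaluation t K], of the
subspaces of words that vanish on some [T].  Such a subspace has codimension at
least [t * d - 1]: forbidding the rows in [T] costs [t * d] dimensions, but the
image under [evaluation t K] shrinks by at most one dimension, since by
[solve_functionals] all values except the one at [T] are still attained. *)
Lemma code_exists t K : (0 < t <= #|K|)%N -> (2 ^ #|K| <= d)%N -> (2 ^ M < #|F|)%N ->
  exists C : {vspace 'M[F]_(M, d)},
    [/\ (C <= words K)%VS, \dim C = (t * d).-1,
        forall x T, x \in C -> T \in subsets_of_size t K -> functional T x = 0 &
        forall x T, x \in C -> T \in subsets_of_size t K ->
          (forall i, i \in T -> row i x = 0) -> x = 0].
Proof.
case/andP=> t0 tK Kd MF; pose TK := subsets_of_size t K.
pose Phi := linfun (evaluation t K).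
have PhiE x T : T \in TK -> Phi x T = functional T x.
  by move=> TTK; rewrite lfunE /= ffunE TTK.
pose H := (words K :&: lker Phi)%VS.
pose Z T := if T \in TK then (words (K :\: T) :&: lker Phi)%VS else 0%VS.
have [T0 T0K] : exists T, T \in TK.
  have /card_geqP[s [us ss sK]] := tK.
  exists [set i in s]; rewrite inE cardsE (card_uniqP us) ss eqxx andbT.
  by apply/subsetP => i; rewrite inE => /sK.
have d0 : (0 < t * d)%N by rewrite muln_gt0 t0 (leq_trans _ Kd) ?expn_gt0.
have hd T : T \in TK -> ((t * d).-1 + \dim (words (K :\: T) :&: lker Phi) <= \dim H)%N.
  move=> TTK; have := limg_ker_dim Phi (words K); rewrite -/H.
  have := limg_ker_dim Phi (words (K :\: T)).
  have /andP[TK' /eqP cT] : (T \subset K) && (#|T| == t) by rewrite inE in TTK.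
  rewrite !dim_words cardsD (setIidPr TK') cT mulnBl.
  have tdK : (t * d <= #|K| * d)%N by rewrite leq_mul2r tK orbT.
  have arith (td kd dH dZ a b : nat) : (0 < td -> td <= kd -> dZ + a = kd - td ->
    dH + b = kd -> b <= a.+1 -> td.-1 + dZ <= dH)%N by lia.
  move=> e1 e2; apply: (arith _ _ _ _ _ _ d0 tdK e1 e2).
  (* [Phi @: words K] exceeds [Phi @: words (K :\: T)] by the coordinate of [T]
     at most. *)
  pose delta : {ffun {set 'I_M} -> F^o} := [ffun T' => (T' == T)%:R].
  apply: (@leq_trans (\dim (Phi @: words (K :\: T) + <[delta]>))); last first.
    apply: leq_trans (dimv_add_leqif _ _).1 _; rewrite -addn1 leq_add2l dim_vline.
    by case: (_ != _).
  apply: dimvS; apply/subvP => _ /memv_imgP[x xK ->].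
  have [||z zK zE] := @solve_functionals (TK :\ T) (K :\: T) (fun T' => functional T' x).
  - by apply: leq_trans (card_subsets_of_size t Kd); rewrite subset_leq_card // subD1set.
  - move=> T'; rewrite !inE => /and3P[T'T T'K /eqP cT'].
    rewrite setIDA (setIidPl T'K) setD_eq0; apply: contra T'T => h.
    by rewrite eqEcard h cT cT' leqnn.
  apply/memv_addP; exists (Phi z); first exact: memv_img.
  exists (functional T x *: delta); first by apply: memvZ; apply: memv_line.
  apply/ffunP => T'; rewrite !ffunE.
  have [TT'|TT'] := boolP (T' \in TK); last first.
    have [E|_] := eqVneq T' T; first by rewrite E TTK in TT'.
    by rewrite !lfunE /= !ffunE (negbTE TT') scaler0 addr0.
  rewrite !PhiE //; have [->|T'T] := eqVneq T' T.
    rewrite [functional T z](_ : _ = 0) ?add0r /=; first by rewrite /GRing.scale /= mulr1.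
    rewrite /functional big1 // => i iT; rewrite big1 // => l _.
    have := wordsP _ _ zK i; rewrite !inE iT => /(_ isT)/rowP/(_ l).
    by rewrite !mxE => ->; rewrite mul0r.
  by rewrite scaler0 addr0 zE // !inE T'T; rewrite inE in TT'.
have IF : (#|{set 'I_M}| < #|F|)%N.
  by rewrite -cardsT -powersetT card_powerset cardsT card_ord.
have ZH T : (Z T <= H)%VS.
  rewrite /Z; case: ifP => _; last exact: sub0v.
  by apply: capvS => //; apply: words_mono; apply: subsetDl.
have Zd T : ((t * d).-1 + \dim (Z T) <= \dim H)%N.
  rewrite /Z; case: ifPn => [/hd //|_]; rewrite dimv0 addn0.
  by apply: leq_trans (hd _ T0K); apply: leq_addr.
have [C [CH dC CZ]] := common_complement T0 IF ZH Zd.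
have Cker x : x \in C -> x \in words K /\ Phi x = 0.
  by move=> /(subvP CH)/memv_capP[h]; rewrite memv_ker => /eqP.
exists C; split=> //.
- by apply: subv_trans CH _; apply: capvSl.
- by move=> x T /Cker[_ /ffunP/(_ T) E] TTK; rewrite -PhiE // E ffunE.
move=> x T xC TTK xT; have [/wordsP xK Px] := Cker _ xC.
apply/eqP; rewrite -memv0 -(CZ T); apply/memv_capP; split=> //; rewrite /Z TTK.
apply/memv_capP; split; last by rewrite memv_ker Px.
apply/wordsP => i; rewrite inE negb_and negbK => /orP[/xT //|/xK //].
Qed.

End Codes.

Lemma card_supersets (M t k : nat) (T : {set 'I_M}) : #|T| = t -> (t <= k)%N ->
  #|[set K : {set 'I_M} | T \subset K & #|K| == k]| = 'C(M - t, k - t).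
Proof.
move=> cT tk; have -> : (M - t = #|~: T|)%N by rewrite cardsCs setCK cT card_ord.
rewrite -cards_draws -[RHS](card_in_imset (f := fun B : {set 'I_M} => T :|: B)); last first.
  move=> A B; rewrite !inE => /andP[AT _] /andP[BT _] E.
  have h (X : {set 'I_M}) : X \subset ~: T -> (T :|: X) :\: T = X.
    by move=> XT; rewrite setDUl setDv set0U setDE; apply/setIidPl.
  by rewrite -(h _ AT) E h.
apply: eq_card => K; rewrite inE; apply/idP/imsetP => [/andP[TK /eqP cK]|[B]].
  exists (K :\: T); last by rewrite -{1}(setIidPr TK) setID.
  by rewrite inE setDE subsetIr -setDE cardsD (setIidPr TK) cK cT eqxx.
rewrite inE => /andP[BT /eqP cB] ->; rewrite subsetUl /= cardsU cT cB.
rewrite (_ : T :&: B = set0) ?cards0 ?subn0 ?subnKC //.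
by apply/eqP; rewrite setI_eq0 disjoints_subset subsetC.
Qed.

Section AlgebraicPacking.

Variables (F : finFieldType) (M d t k a : nat) (alpha : {set 'I_M} -> F).
Hypotheses (t_gt0 : (0 < t)%N) (le_tk : (t <= k)%N) (alpha_inj : injective alpha).
Hypotheses (kd : (2 ^ k <= d)%N) (MF : (2 ^ M < #|F|)%N).
Hypothesis aF : (a * 'C(M - t, k - t) <= #|F|)%N.

Definition point := ('I_M * 'rV[F]_d)%type.

Definition graph_of (K : {set 'I_M}) (x : 'M[F]_(M, d)) : {set point} :=
  [set (i, row i x) | i in K].

Lemma card_graph_of K x : #|graph_of K x| = #|K|.
Proof. by apply: card_imset => i j []. Qed.

(** The functionals have constant values on each translate of a code, and for
fixed [T] the pairs [(K, j)] with [T] inside [K] get distinct values: there are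
[a * 'C(M - t, k - t)] of them, at most [#|F|].  If two blocks share [t] points,
the value of the functional at these points reveals that [K] and [j] agree, and
the difference of the two words is a code word that vanishes on [t] rows. *)
Lemma algebraic_packing : exists Q : {set {set point}},
  packing t k Q /\ #|Q| = ('C(M, k) * a * #|F| ^ (t * d).-1)%N.
Proof.
pose is_code (K : {set 'I_M}) (C : {vspace 'M[F]_(M, d)}) := #|K| = k ->
    [/\ (C <= words F d K)%VS, \dim C = (t * d).-1,
        forall x T, x \in C -> T \in subsets_of_size t K -> functional alpha T x = 0 &
        forall x T, x \in C -> T \in subsets_of_size t K ->
          (forall i, i \in T -> row i x = 0) -> x = 0].
have [C CP] : exists C, forall K, is_code K (C K).
  apply: fin_all_exists => K; rewrite /is_code.
  have [cK|cK] := eqVneq #|K| k; last by exists 0%VS => /eqP; rewrite (negbTE cK).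
  have [|||C hC] := @code_exists F M d alpha alpha_inj t K; rewrite ?cK ?t_gt0 //.
  by exists C.
pose D (T : {set 'I_M}) := [set p : {set 'I_M} * 'I_a | (T \subset p.1) && (#|p.1| == k)].
(* The value prescribed for the functional of [T] on the translate [p]. *)
pose color T p : F := nth 0 (enum F) (index p (enum (D T))).
have color_inj (T : {set 'I_M}) : #|T| = t -> {in D T &, injective (color T)}.
  move=> cT p p' pD p'D; have cD : (#|D T| <= #|F|)%N.
    apply: leq_trans aF; rewrite -(card_supersets cT le_tk) mulnC -[a in leqRHS]card_ord.
    rewrite -cardsT -cardsX; apply: subset_leq_card; apply/subsetP => -[K j].
    by rewrite !inE andbT.
  have lt p0 : p0 \in D T -> (index p0 (enum (D T)) < size (enum F))%N.
    by move=> h; rewrite -cardT (leq_trans _ cD) // cardE index_mem mem_enum.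
  move/eqP; rewrite nth_uniq ?enum_uniq ?lt // => /eqP.
  have pe : p \in enum (D T) by rewrite mem_enum.
  have pe' : p' \in enum (D T) by rewrite mem_enum.
  by move=> E; rewrite -(nth_index p pe) -(nth_index p pe') E.
(* A word with all the prescribed values moves the code of [K] into place. *)
pose is_shift (p : {set 'I_M} * 'I_a) (x : 'M[F]_(M, d)) := #|p.1| = k ->
  forall T, T \in subsets_of_size t p.1 -> functional alpha T x = color T p.
have [sh shP] : exists sh, forall p, is_shift p (sh p).
  apply: fin_all_exists => -[K j]; rewrite /is_shift /=.
  have [cK|cK] := eqVneq #|K| k; last by exists 0 => /eqP; rewrite (negbTE cK).
  have [||x _ xP] := @solve_functionals F M d alpha alpha_inj (subsets_of_size t K) K
      (fun T => color T (K, j)).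
  - by apply: card_subsets_of_size; rewrite cK.
  - move=> T; rewrite inE => /andP[TK /eqP cT].
    by rewrite (setIidPl TK) -card_gt0 cT.
  by exists x.
pose I := [set p : ({set 'I_M} * 'I_a) * 'M[F]_(M, d) |
  (#|p.1.1| == k) && (p.2 \in C p.1.1)].
pose blk p : {set point} := graph_of p.1.1 (sh p.1 + p.2).
have share p p' : p \in I -> p' \in I -> (t <= #|blk p :&: blk p'|)%N -> p = p'.
  case: p p' => [[K j] x] [[K' j'] x']; rewrite !inE /= => /andP[/eqP cK xC] /andP[/eqP cK' xC'].
  case/card_geqP => s [us ss sX].
  have rowE i y : (i, y) \in s ->
      [/\ i \in K, i \in K', y = row i (sh (K, j) + x) & y = row i (sh (K', j') + x')].
    move/sX; rewrite in_setI => /andP[/imsetP[i1 h1 e1] /imsetP[i2 h2 e2]].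
    move: e1 e2 => [-> ->] [e2 e3].
    by split=> //; rewrite ?e3 e2.
  pose T := [set p.1 | p in [set p in s]].
  have Tin i : i \in T -> [/\ i \in K, i \in K' &
      row i (sh (K, j) + x) = row i (sh (K', j') + x')].
    by case/imsetP=> -[i0 y]; rewrite inE => /rowE[h1 h2 e1 e2] -> /=; split; rewrite // -e1.
  have cT : #|T| = t.
    rewrite card_in_imset ?cardsE ?(card_uniqP us) // => -[i y] [i' y'].
    by rewrite !inE => /rowE[_ _ -> _] /rowE[_ _ -> _] /= ->.
  have TK : T \in subsets_of_size t K.
    by rewrite inE cT eqxx andbT; apply/subsetP => i /Tin[].
  have TK' : T \in subsets_of_size t K'.
    by rewrite inE cT eqxx andbT; apply/subsetP => i /Tin[].
  have [_ _ C0 C1] := CP _ cK; have [_ _ C0' _] := CP _ cK'.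
  have funE : functional alpha T (sh (K, j) + x) = functional alpha T (sh (K', j') + x').
    apply: eq_bigr => i /Tin[_ _ E]; apply: eq_bigr => l _; congr (_ * _).
    by move/rowP/(_ l): E; rewrite !mxE.
  have E : (K, j) = (K', j').
    apply: (color_inj T cT).
    - by move: TK; rewrite !inE /= cK eqxx andbT => /andP[].
    - by move: TK'; rewrite !inE /= cK' eqxx andbT => /andP[].
    move: funE; rewrite !linearD /= (shP (K, j)) // (shP (K', j')) //.
    by rewrite C0 // C0' // !addr0.
  case: E xC' Tin => <- <- xC' Tin; congr (_, _); apply/eqP; rewrite -subr_eq0; apply/eqP.
  apply: (C1 _ T) => //; first by rewrite rpredB.
  move=> i /Tin[_ _]; rewrite !linearD /= => /addrI ->.
  by rewrite linearN /= subrr.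
have kI p : p \in I -> #|blk p| = k.
  by rewrite inE card_graph_of => /andP[/eqP].
exists (blk @: I); split.
  split=> [_ /imsetP[p /kI + ->] //|_ _ /imsetP[p pI ->] /imsetP[p' p'I ->] h].
  by rewrite (share _ _ pI p'I h).
rewrite card_in_imset => [|p p' pI p'I E]; last by apply: share; rewrite // E setIid kI.
transitivity (\sum_(p : {set 'I_M} * 'I_a | #|p.1| == k) #|F| ^ (t * d).-1)%N.
  rewrite -sum1_card (eq_bigl (fun p : ({set 'I_M} * 'I_a) * 'M[F]_(M, d) => (#|p.1.1| == k) && (p.2 \in C p.1.1))); last first.
    by move=> p; rewrite inE.
  rewrite -(pair_big_dep (fun p : {set 'I_M} * 'I_a => #|p.1| == k)
     (fun p x => x \in C p.1) (fun _ _ => 1%N)) /=.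
  apply: eq_bigr => p /eqP cK; have [_ dC _ _] := CP _ cK.
  by rewrite sum1_card card_vspace dC.
rewrite sum_nat_const; congr (_ * _)%N.
rewrite -[in RHS](card_ord M) -card_draws -[a in RHS]card_ord -[#|'I_a|]cardsT -cardsX.
by apply: eq_card => -[K j]; rewrite !inE andbT.
Qed.

End AlgebraicPacking.

End LinearAlgebra.

(** * Packings that cover almost all t-sets *)

Lemma packing_imset (X Y : finType) (f : X -> Y) t k (Q : {set {set X}}) :
  injective f -> packing t k Q ->
  packing t k [set f @: (K : {set X}) | K in Q] /\ #|[set f @: (K : {set X}) | K in Q]| = #|Q|.
Proof.
move=> finj [Qk Qt]; split; last by apply: card_imset; apply: imset_inj.
split=> [_ /imsetP[K KQ ->]|_ _ /imsetP[K KQ ->] /imsetP[K' K'Q ->] h].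
  by rewrite card_imset // Qk.
suff -> : K = K' by []; apply: Qt => //.
by rewrite -(card_imset _ finj) imsetI // => x y _ _; apply: finj.
Qed.

Lemma ffact_le_expn m t : m ^_ t <= m ^ t.
Proof.
elim: t => [|t IH]; first by rewrite ffactn0 expn0.
by rewrite ffactnSr expnSr leq_mul // leq_subr.
Qed.

Lemma expn_le_ffact M t : t <= M ->
  M.+1 * M.+1 ^ t <= M.+1 * M ^_ t + t * t * M.+1 ^ t.
Proof.
elim: t => [|t IH] tM; first by rewrite ffactn0 expn0 mul0n addn0.
have {}IH := leq_mul (leqnn M.+1) (IH (ltnW tM)).
have h : M ^_ t <= M.+1 ^ t.
  by apply: leq_trans (ffact_le_expn M t) _; case: (t) => // t'; rewrite leq_exp2r.
have E : (M - t) + t.+1 = M.+1 by rewrite addnS subnK // ltnW.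
rewrite expnS ffactnSr; apply: leq_trans IH _.
have := leq_mul (leqnn (t.+1 * M.+1)) h.
have : M.+1 * (M.+1 * M ^_ t) = M.+1 * (M ^_ t * (M - t)) + t.+1 * M.+1 * M ^_ t.
  by rewrite -{2}E; lia.
move: (M ^_ t) (M.+1 ^ t) (M - t) M.+1 => x y z w e1 e2.
by rewrite mulnDr e1; lia.
Qed.

Lemma mul_bin_supersets M k t : t <= k -> k <= M ->
  'C(M, k) * 'C(k, t) = 'C(M, t) * 'C(M - t, k - t).
Proof.
move=> tk kM.
have e1 := bin_fact kM; have e2 := bin_fact tk; have e3 := bin_fact (leq_trans tk kM).
have e4 := bin_fact (leq_sub2r t kM); rewrite subnBA // subnK ?(leq_trans tk kM) // in e4.
have X0 : 0 < t`! * (k - t)`! * (M - k)`! by rewrite !muln_gt0 !fact_gt0.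
apply/eqP; rewrite -(eqn_pmul2r X0); apply/eqP.
transitivity (M`!); first by rewrite -e1 -e2; lia.
by rewrite -e3 -e4; lia.
Qed.

(** Here ['C(m, t)] is at most [(M + 1)^t N^t / t!].  The factor
[M ^_ t / (M + 1)^t] accounts for the [t]-sets that meet a copy twice or contain
one of the fewer than [N] excess points, and the factor
[a * 'C(M - t, k - t) / q] for the values that no translate uses.  Both factors
are at least [1 - 1 / (4 e)]. *)
Lemma bin_bound_packing (e t k M m q a N : nat) :
  0 < e -> t <= k -> k <= M -> 4 * e * (t * t) <= M ->
  4 * e * 'C(M - t, k - t) <= q -> q < (a.+1) * 'C(M - t, k - t) ->
  m < M.+1 * N ->
  e * 'C(m, t) * q <= 'C(m, t) * q + e * ('C(k, t) * ('C(M, k) * a * N ^ t)).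
Proof.
move=> e0 tk kM tM lq ql mM; set l := 'C(M - t, k - t) in lq ql *.
have -> : 'C(k, t) * ('C(M, k) * a * N ^ t) = 'C(M, t) * (l * a) * N ^ t.
  have := mul_bin_supersets tk kM; rewrite -/l.
  move: 'C(k, t) 'C(M, k) 'C(M, t) (N ^ t) => b c d p E.
  have -> : b * (c * a * p) = c * b * (a * p) by lia.
  by rewrite E; lia.
have t_gt0 := fact_gt0 t.
rewrite -(leq_pmul2r t_gt0) mulnDl.
have eB : 'C(m, t) * q * t`! = m ^_ t * q by rewrite mulnAC bin_ffact.
have -> : e * 'C(m, t) * q * t`! = e * (m ^_ t * q) by rewrite -eB; lia.
have -> : e * ('C(M, t) * (l * a) * N ^ t) * t`! = e * (M ^_ t * (l * a) * N ^ t).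
  by rewrite -bin_ffact; lia.
rewrite eB.
have h1 : m ^_ t <= M.+1 ^ t * N ^ t.
  by apply: leq_trans (ffact_le_expn _ _) _; rewrite -expnMn; case: (t) => // t'; rewrite leq_exp2r // ltnW.
have h2 : 4 * e * M.+1 ^ t <= 4 * e * M ^_ t + M.+1 ^ t.
  have := leq_mul (leqnn (4 * e)) (expn_le_ffact (leq_trans tk kM)).
  have := leq_mul (leqW tM) (leqnn (M.+1 ^ t)).
  move: (M ^_ t) (M.+1 ^ t) (t * t) => y x tt a1 a2.
  rewrite -(leq_pmul2l (ltn0Sn M)); lia.
have h3 : 4 * e * q <= 4 * e * (l * a) + q.
  have : 4 * e * q <= 4 * e * (a.+1 * l) by rewrite leq_mul2l (ltnW ql) orbT.
  have -> : a.+1 * l = l * a + l by rewrite mulSn addnC mulnC.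
  by rewrite mulnDr => /leq_trans; apply; rewrite leq_add2l.
move: (M ^_ t) (M.+1 ^ t) (l * a) (N ^ t) (m ^_ t) h1 h2 h3 => y x s p b h1 h2 h3.
case: e e0 {tM lq} h2 h3 => // e _ h2 h3.
(* Two losses of a factor [1 - 1/(4e)] are less than one of [1 - 1/e]. *)
suff h4 : e * (x * q) <= e.+1 * (y * s).
  have := leq_mul (leqnn (e * q)) h1; have := leq_mul h4 (leqnn p).
  by rewrite mulSn; lia.
have h2' : (4 * e + 3) * x <= 4 * e.+1 * y by lia.
have h3' : (4 * e + 3) * q <= 4 * e.+1 * s by lia.
have h5 := leq_mul h2' h3'.
have e20 : 0 < 16 * (e.+1 * e.+1) by rewrite !muln_gt0.
rewrite -(leq_pmul2l e20).
apply: (@leq_trans (e.+1 * ((4 * e + 3) * x * ((4 * e + 3) * q)))).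
  have -> : e.+1 * ((4 * e + 3) * x * ((4 * e + 3) * q)) =
    (e.+1 * ((4 * e + 3) * (4 * e + 3))) * (x * q) by lia.
  by rewrite mulnA leq_mul2r; apply/orP; right; nia.
apply: leq_trans (leq_mul (leqnn e.+1) h5) _.
by apply: eq_leq; lia.
Qed.

(** For given [m] the field has [2 ^ r] elements with [r] as large as [m] permits
when at least [M0] copies are wanted.  Then the number [M] of copies stays below
the constant [M0 * 2 ^ d], while the field grows with [m]. *)
Lemma inner_packing e t k : 0 < e -> 0 < t -> t <= k ->
  exists m0, forall m, m0 <= m -> exists Q : {set {set 'I_m}},
    packing t k Q /\ e * 'C(m, t) <= 'C(m, t) + e * ('C(k, t) * #|Q|).
Proof.
move=> e0 t0 tk.
pose d := 2 ^ k; pose M0 := 4 * e * (t * t) + k; pose M1 := M0 * 2 ^ d.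
(* [2 ^ M1] bounds both the number of sets of copies, each of which needs a
   node of its own, and the number of blocks above a [t]-set. *)
pose r0 := 4 * e * 2 ^ M1.
have M00 : 0 < M0 by rewrite addn_gt0 !muln_gt0 e0 t0.
exists (M0 * (2 ^ d) ^ r0) => m mm0.
pose r := trunc_log (2 ^ d) (m %/ M0).
have d0 : 0 < d by rewrite expn_gt0.
have p1 : 1 < 2 ^ d by rewrite -(expn0 2) ltn_exp2l.
have r0r : r0 <= r.
  by apply: trunc_log_max => //; rewrite leq_divRL // mulnC.
have r00 : 0 < r0 by rewrite !muln_gt0 e0 expn_gt0.
have mM0 : 0 < m %/ M0.
  by rewrite divn_gt0 // (leq_trans _ mm0) // leq_pmulr // expn_gt0 expn_gt0.
have /andP[hr hr'] := trunc_log_bounds p1 mM0; rewrite -/r in hr hr'.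
have [F _ cF] := @pPrimePowerField 2 r isT (leq_trans r00 r0r).
pose N := (2 ^ d) ^ r; have N0 : 0 < N by rewrite !expn_gt0.
have NE : N = #|F| ^ d by rewrite cF /N -!expnM mulnC.
pose M := m %/ N.
have MM0 : M0 <= M by rewrite leq_divRL // mulnC -leq_divRL.
have MM1 : M < M1.
  by rewrite ltn_divLR // /M1 -mulnA -expnS mulnC -ltn_divLR.
have qr : 4 * e * 2 ^ M1 <= #|F|.
  by rewrite cF; apply: (leq_trans r0r); apply: ltnW; apply: ltn_expl.
have kM : k <= M by apply: leq_trans MM0; apply: leq_addl.
pose l := 'C(M - t, k - t).
have l0 : 0 < l by rewrite bin_gt0 leq_sub2r.
have lM : l <= 2 ^ M1.
  apply: (@leq_trans (2 ^ (M - t))).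
    have := max_card (mem [set A : {set 'I_(M - t)} | #|A| == k - t]).
    rewrite card_draws card_ord => /leq_trans; apply.
    by rewrite -cardsT -powersetT card_powerset cardsT card_ord.
  by rewrite leq_exp2l // (leq_trans (leq_subr _ _)) // ltnW.
pose a := #|F| %/ l.
have MF : 2 ^ M < #|F|.
  apply: leq_trans qr; apply: (@leq_trans (2 ^ M1)); first by rewrite ltn_exp2l.
  by rewrite leq_pmull // muln_gt0.
have [alpha alpha_inj] : exists alpha : {set 'I_M} -> F, injective alpha.
  apply: exists_injection; apply: leq_trans (ltnW MF).
  by rewrite -cardsT -powersetT card_powerset cardsT card_ord.
have [Q [Qp cQ]] := @algebraic_packing F M d t k a alpha t0 tk alpha_inj (leqnn _) MF (leq_divM _ _).
have cP : #|{: point F M d}| <= #|'I_m|.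
  by rewrite card_prod card_mx mul1n !card_ord -NE leq_divM.
have [f finj] := exists_injection cP.
have [Qp' cQ'] := packing_imset finj Qp.
exists [set f @: (K : {set point F M d}) | K in Q]; split=> //; rewrite cQ' cQ.
have q0 : 0 < #|F| by apply: leq_trans MF.
rewrite -(leq_pmul2r q0) mulnDl.
have -> : e * ('C(k, t) * ('C(M, k) * a * #|F| ^ (t * d).-1)) * #|F| =
  e * ('C(k, t) * ('C(M, k) * a * N ^ t)).
  rewrite NE -expnM (mulnC d) -{2}(prednK (_ : 0 < t * d)) ?muln_gt0 ?t0 // expnSr.
  by rewrite !mulnA.
apply: bin_bound_packing => //.
- by apply: leq_trans MM0; apply: leq_addr.
- by apply: leq_trans qr; rewrite leq_mul2l lM orbT.
- exact: ltn_ceil.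
- exact: ltn_ceil.
Qed.

(** * Randomly permuted packings *)

Section RandomPermutation.

Variables (V : finType) (U : {set V}).

Definition Perms : {set {perm V}} := [set s | perm_on U s].

Lemma card_Perms : #|Perms| = #|U|`!.
Proof. by rewrite -card_perm; apply: eq_card => s; rewrite inE. Qed.

Lemma perm_imset_sub (s : {perm V}) (Y : {set V}) : s \in Perms -> Y \subset U -> s @: Y \subset U.
Proof.
rewrite inE => sU /subsetP YU; apply/subsetP => _ /imsetP[x /YU xU ->].
by rewrite perm_closed.
Qed.

Lemma exists_perm_moving (Y Y' : {set V}) : Y \subset U -> Y' \subset U -> #|Y| = #|Y'| ->
  exists2 s : {perm V}, s \in Perms & s @: Y = Y'.
Proof.
move=> + Y'U; elim: {Y}#|Y :\: Y'| {-2}Y (erefl #|Y :\: Y'|) => [|n IH] Y cD YU cY.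
  exists 1%g; first by rewrite inE perm_on1.
  rewrite (eq_imset (g := id)) ?imset_id; last by move=> x; rewrite perm1.
  by apply/eqP; rewrite eqEcard cY leqnn andbT -setD_eq0 -cards_eq0 cD.
have /card_gt0P[a] : 0 < #|Y :\: Y'| by rewrite cD.
rewrite inE => /andP[aY' aY].
have /card_gt0P[b] : 0 < #|Y' :\: Y|.
  by rewrite cardsD -cY setIC -cardsD cD.
rewrite inE => /andP[bY bY'].
have sU : perm_on U (tperm a b).
  apply: subset_trans (tperm_on a b) _; apply/subsetP => x; rewrite !inE.
  by case/orP=> /eqP->; [apply: (subsetP YU)|apply: (subsetP Y'U)].
have YE : tperm a b @: Y = b |: Y :\ a.
  apply/setP => x; apply/imsetP/idP => [[y yY ->]|].
    case: tpermP => [_|yb|/eqP ya /eqP yb]; rewrite !inE ?eqxx //.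
      by rewrite yb (negbTE bY) in yY.
    by rewrite ya yY orbT.
  rewrite !inE => /orP[/eqP->|/andP[xa xY]]; first by exists a; rewrite ?tpermL.
  exists x => //; rewrite tpermD // eq_sym //.
  by apply: contraNneq bY => <-.
have [|||s sP sE] := IH (tperm a b @: Y).
- have : #|(b |: Y :\ a) :\: Y'| = #|(Y :\: Y') :\ a|.
    apply: eq_card => x; rewrite !inE; case: (eqVneq x b) => [->|_] /=.
      by move: bY' => ->; rewrite /= ?andbF.
    by case: (x == a); rewrite ?andbF.
  rewrite -YE => ->.
  by move: cD; rewrite (cardsD1 a) !inE aY aY' => -[].
- by apply: perm_imset_sub; rewrite ?inE.
- by rewrite card_imset //; apply: perm_inj.
exists (tperm a b * s)%g; first by move: sP; rewrite !inE => sP; apply: perm_onM.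
by rewrite -sE -imset_comp; apply: eq_imset => x; rewrite permM.
Qed.

(** The permutations of [U] act transitively on its subsets of a given size, so
the image of [Y] is uniformly distributed among them. *)
Lemma card_perm_image (Y : {set V}) (YY : {set {set V}}) : Y \subset U ->
  (forall Y', Y' \in YY -> Y' \subset U /\ #|Y'| = #|Y|) ->
  #|[set s in Perms | s @: Y \in YY]| * 'C(#|U|, #|Y|) = #|YY| * #|U|`!.
Proof.
move=> YU YYP; pose N (Y' : {set V}) := #|[set s in Perms | s @: Y == Y']|.
have Nle (Y1 Y2 : {set V}) : Y1 \subset U -> Y2 \subset U -> #|Y1| = #|Y2| -> N Y1 <= N Y2.
  move=> Y1U Y2U c12; have [s sP sE] := exists_perm_moving Y1U Y2U c12.
  rewrite /N -(card_imset (f := fun p : {perm V} => (p * s)%g)); last exact: mulIg.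
  apply/subset_leq_card/subsetP => _ /imsetP[p + ->]; rewrite in_set => /andP[pP /eqP pE].
  rewrite in_set.
  move: sP pP; rewrite !inE => sP pP; rewrite perm_onM //= -sE -pE -imset_comp; apply/eqP.
  by apply: eq_imset => x; rewrite permM.
have count (ZZ : {set {set V}}) : (forall Y', Y' \in ZZ -> Y' \subset U /\ #|Y'| = #|Y|) ->
    #|[set s in Perms | s @: Y \in ZZ]| = #|ZZ| * N Y.
  move=> ZP; transitivity (\sum_(Y' in ZZ) N Y').
    rewrite -sum1_card (partition_big (fun s : {perm V} => s @: Y) (mem ZZ)) /=; last first.
      by move=> s; rewrite inE => /andP[].
    apply: eq_bigr => Y' Y'Z; rewrite /N -sum1_card; apply: eq_bigl => s.
    by rewrite !inE -andbA; case: eqP => [->|]; rewrite ?Y'Z ?andbF.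
  rewrite -sum_nat_const; apply: eq_bigr => Y' /ZP[Y'U cY'].
  by apply/eqP; rewrite eqn_leq !Nle.
rewrite (count _ YYP) -mulnA; congr (_ * _).
rewrite mulnC -cards_draws -card_Perms -count => [|Y']; last first.
  by rewrite inE => /andP[-> /eqP->].
apply: eq_card => s; rewrite inE; case sP: (s \in Perms) => //=.
rewrite inE perm_imset_sub // card_imset ?eqxx //; exact: perm_inj.
Qed.

End RandomPermutation.

Lemma card_uncovered_in (V : finType) (U : {set V}) t k (Q : {set {set V}}) :
  packing t k Q -> (forall K, K \in Q -> K \subset U) ->
  #|[set T : {set V} | [&& T \subset U, #|T| == t & ~~ [exists K in Q, T \subset K]]]| +
    'C(k, t) * #|Q| <= 'C(#|U|, t).
Proof.
move=> [Qk Qt] QU; set X := [set T : {set V} | _].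
pose P := [set p : {set V} * {set V} | [&& p.1 \in Q, p.2 \subset p.1 & #|p.2| == t]].
have cP : #|P| = 'C(k, t) * #|Q|.
  rewrite -sum1_card (eq_bigl (fun p : {set V} * {set V} =>
    (p.1 \in Q) && ((p.2 \subset p.1) && (#|p.2| == t)))); last by move=> p; rewrite inE.
  rewrite -(pair_big_dep (fun K : {set V} => K \in Q)
    (fun K T : {set V} => (T \subset K) && (#|T| == t)) (fun _ _ => 1)) /=.
  rewrite mulnC -sum_nat_const; apply: eq_bigr => K KQ.
  by rewrite -(Qk _ KQ) -cards_draws -sum1_card; apply: eq_bigl => T; rewrite inE.
have snd_inj : {in P &, injective snd}.
  move=> [K T] [K' T']; rewrite !inE /= => /and3P[KQ TK /eqP cT] /and3P[K'Q T'K' _] E.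
  rewrite -E in T'K' *; congr (_, _); apply: Qt => //.
  by rewrite -cT subset_leq_card // subsetI TK.
have dis : [disjoint X & snd @: P].
  rewrite -setI_eq0; apply/eqP/setP => T; rewrite [in RHS]inE; apply/negP => /setIP[].
  rewrite inE => /and3P[_ _ /exists_inPn h] /imsetP[[K T'] + TE].
  by rewrite inE /= => /and3P[KQ TK _]; have := h _ KQ; rewrite TE TK.
rewrite -cP -(card_in_imset snd_inj) -cards_draws.
have := (leq_card_setU X (snd @: P)).2; rewrite dis => /eqP <-.
apply: subset_leq_card; apply/subsetP => T /setUP[].
  by rewrite /X !in_set => /and3P[-> -> _].
case/imsetP=> -[K T'] pP ->; move: pP; rewrite [_ \in P]in_set /= => /and3P[KQ TK cT].
by rewrite inE cT (subset_trans TK (QU _ KQ)).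
Qed.

Section RandomPacking.

Variables (V : finType) (U : {set V}) (t k : nat) (Q : {set {set V}}).
Hypotheses (Qp : packing t k Q) (QU : forall K, K \in Q -> K \subset U).
Hypotheses (tk : t <= k) (tU : t <= #|U|).

(** The random packing consists of the sets [K] with [s @: K] in [Q], so [T] is
uncovered when [s @: T] is; each [t]-subset of [U] is equally likely to be
[s @: T]. *)
Lemma random_uncovered e (T : {set V}) : T \subset U -> #|T| = t ->
  e * 'C(#|U|, t) <= 'C(#|U|, t) + e * ('C(k, t) * #|Q|) ->
  e * #|[set s in Perms U | ~~ [exists K in Q, s @: T \subset K]]| <= #|U|`!.
Proof.
move=> TU cT eQ.
set X := [set T' : {set V} | [&& T' \subset U, #|T'| == t & ~~ [exists K in Q, T' \subset K]]].
have XP Y : Y \in X -> Y \subset U /\ #|Y| = #|T|.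
  by rewrite inE cT => /and3P[-> /eqP-> _].
have := card_perm_image TU XP; rewrite cT.
have -> : [set s in Perms U | s @: T \in X] =
    [set s in Perms U | ~~ [exists K in Q, s @: T \subset K]].
  apply/setP => s; rewrite !inE; case sP: (perm_on U s) => //=.
  by rewrite perm_imset_sub ?inE // card_imset ?cT ?eqxx //; apply: perm_inj.
have := card_uncovered_in Qp QU; rewrite -/X.
have : 0 < 'C(#|U|, t) by rewrite bin_gt0.
move: #|[set s in _ | _]| #|X| ('C(k, t) * #|Q|) 'C(#|U|, t) eQ => a x c d eQ d0 h1 h2.
rewrite -(leq_pmul2r d0) -mulnA h2 mulnA mulnC leq_mul2l; apply/orP; right.
by rewrite -(leq_add2r (e * c)) -mulnDr (leq_trans _ eQ) // leq_mul2l h1 orbT.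
Qed.

Lemma random_contained (Y : {set V}) : Y \subset U ->
  #|[set s in Perms U | [exists K in Q, s @: Y \subset K]]| * 'C(#|U|, #|Y|) <=
  2 ^ k * 'C(#|U|, t) * #|U|`!.
Proof.
move=> YU.
set X := [set Y' : {set V} | [&& Y' \subset U, #|Y'| == #|Y| & [exists K in Q, Y' \subset K]]].
have XP Y' : Y' \in X -> Y' \subset U /\ #|Y'| = #|Y|.
  by rewrite inE => /and3P[-> /eqP-> _].
have -> : [set s in Perms U | [exists K in Q, s @: Y \subset K]] =
    [set s in Perms U | s @: Y \in X].
  apply/setP => s; rewrite !inE; case sP: (perm_on U s) => //=.
  by rewrite perm_imset_sub ?inE // card_imset ?eqxx //; apply: perm_inj.
rewrite (card_perm_image YU XP) leq_mul2r; apply/orP; right.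
apply: (@leq_trans (#|Q| * 2 ^ k)).
  apply: (@leq_trans #|\bigcup_(K in Q) powerset K|).
    apply/subset_leq_card/subsetP => Y'; rewrite inE => /and3P[_ _ /exists_inP[K KQ YK]].
    by apply/bigcupP; exists K; rewrite ?inE.
  apply: leq_trans (leq_card_bigcup _ _) _; rewrite -sum_nat_const.
  by apply: leq_sum => K KQ; rewrite card_powerset (proj1 Qp).
rewrite mulnC leq_mul2l; apply/orP; right.
have := card_uncovered_in Qp QU; apply: leq_trans; apply: leq_trans (leq_addl _ _).
by apply: leq_pmull; rewrite bin_gt0.
Qed.

Lemma random_contained1 (Y : {set V}) : Y \subset U -> #|Y| = t.+1 ->
  #|[set s in Perms U | [exists K in Q, s @: Y \subset K]]| * (#|U| - t) <=
  2 ^ k * t.+1 * #|U|`!.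
Proof.
move=> YU cY; have := random_contained YU; rewrite cY.
have := mul_bin_left #|U| t; have : 0 < 'C(#|U|, t) by rewrite bin_gt0.
move: #|[set s in _ | _]| (2 ^ k) 'C(#|U|, t) 'C(#|U|, t.+1) (#|U|`!) (#|U| - t) => a b c d f g c0 h1 h2.
rewrite -(leq_pmul2l c0).
have -> : c * (a * g) = t.+1 * (a * d) by rewrite [t.+1 * _]mulnCA h1; lia.
by apply: leq_trans (leq_mul (leqnn _) h2) _; apply: eq_leq; lia.
Qed.

Lemma random_contained2 (Y : {set V}) : Y \subset U -> #|Y| = t.+2 ->
  #|[set s in Perms U | [exists K in Q, s @: Y \subset K]]| * ((#|U| - t) * (#|U| - t.+1)) <=
  2 ^ k * (t.+1 * t.+2) * #|U|`!.
Proof.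
move=> YU cY; have := random_contained YU; rewrite cY.
have := mul_bin_left #|U| t.+1; have := mul_bin_left #|U| t.
have : 0 < 'C(#|U|, t) by rewrite bin_gt0.
move: #|[set s in _ | _]| (2 ^ k) 'C(#|U|, t) 'C(#|U|, t.+1) 'C(#|U|, t.+2) (#|U|`!) (#|U| - t) (#|U| - t.+1).
move=> a b c d d' f g g' c0 h1 h1' h2.
rewrite -(leq_pmul2l c0).
have -> : c * (a * (g * g')) = t.+1 * t.+2 * (a * d').
  have -> : c * (a * (g * g')) = a * g' * (g * c) by lia.
  rewrite -h1; have -> : a * g' * (t.+1 * d) = a * t.+1 * (g' * d) by lia.
  by rewrite -h1'; lia.
by apply: leq_trans (leq_mul (leqnn _) h2) _; apply: eq_leq; lia.
Qed.

(** A collision involves a point [z] outside [T] and a point [x] of the block.  If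
[x] lies in [T], the block contains the [t + 1] points of [z |: T], which has
probability of order [1/m], for at most [t * d] pairs.  Otherwise it contains
[t + 2] given points, which has probability of order [1/m^2], for at most
[m * d] pairs. *)
Lemma random_collision (d : nat) (T : {set V}) (coll : rel V) :
  T \subset U -> #|T| = t -> symmetric coll ->
  (forall x, x \in U -> #|[set z in U | (z != x) && coll x z]| <= d) ->
  (forall x z, x \in T -> z \in T -> x != z -> ~~ coll x z) ->
  2 * t.+1 <= #|U| ->
  #|U| * #|[set s in Perms U | [exists K : {set V}, [&& s @: K \in Q, T \subset K &
     [exists x in K, exists z in K, (x != z) && coll x z]]]]| <=
  (2 * (t * d * (2 ^ k * t.+1)) + 4 * (d * (2 ^ k * (t.+1 * t.+2)))) * #|U|`!.
Proof.
move=> TU cT csym deg Tfree mt.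
pose B (x z : V) := [set s in Perms U | [exists K in Q, s @: (x |: (z |: T)) \subset K]].
pose Zs (x : V) := [set z in U | (z != x) && coll x z].
pose B1 := \bigcup_(x in T) \bigcup_(z in Zs x :\: T) B x z.
pose B2 := \bigcup_(x in U :\: T) \bigcup_(z in Zs x :\: T) B x z.
set m := #|U| in mt *.
have h1 : m * #|B1| <= t * (d * (2 * (2 ^ k * t.+1 * m`!))).
  rewrite -[X in _ <= X * _]cT; apply: card_bigcup_bound => x xT.
  apply: (@leq_trans (#|Zs x :\: T| * (2 * (2 ^ k * t.+1 * m`!)))).
    apply: card_bigcup_bound => z; rewrite 2!inE => /andP[zT /andP[zU _]].
    have YE : x |: (z |: T) = z |: T by apply/setUidPr; rewrite sub1set inE xT orbT.
    have := @random_contained1 (z |: T); rewrite cardsU1 zT cT => /(_ _ erefl) h.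
    have {}h := h _; rewrite /B YE.
    have zTU : z |: T \subset U by rewrite subUset sub1set zU.
    have {}h := h zTU; rewrite -/m in h.
    apply: (@leq_trans (2 * (#|[set s in Perms U | [exists K in Q, s @: (z |: T) \subset K]]| * (m - t)))).
      move: #|[set s in _ | _]| => a; have -> : 2 * (a * (m - t)) = 2 * (m - t) * a by lia.
      by rewrite leq_mul2r; apply/orP; right; lia.
    by rewrite leq_mul2l h orbT.
  rewrite leq_mul2r (leq_trans (subset_leq_card (subsetDl _ _))) ?orbT //.
  exact: deg (subsetP TU _ xT).
have h2 : m * m * #|B2| <= m * (d * (4 * (2 ^ k * (t.+1 * t.+2) * m`!))).
  apply: (@leq_trans (#|U :\: T| * (d * (4 * (2 ^ k * (t.+1 * t.+2) * m`!))))); last first.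
    by rewrite leq_mul2r subset_leq_card ?subsetDl ?orbT.
  apply: card_bigcup_bound => x; rewrite inE => /andP[xT xU].
  apply: (@leq_trans (#|Zs x :\: T| * (4 * (2 ^ k * (t.+1 * t.+2) * m`!)))).
    apply: card_bigcup_bound => z; rewrite 2!inE => /andP[zT /andP[zU /andP[zx _]]].
    have cY : #|x |: (z |: T)| = t.+2.
      by rewrite !cardsU1 zT cT !inE negb_or xT eq_sym zx.
    have YU : x |: (z |: T) \subset U by rewrite !subUset !sub1set xU zU.
    have := random_contained2 YU cY; rewrite -/m -/(B x z) => h.
    apply: leq_trans (leq_mul (leqnn 4) h).
    have -> : 4 * (#|B x z| * ((m - t) * (m - t.+1))) = (2 * (m - t)) * (2 * (m - t.+1)) * #|B x z| by lia.
    by rewrite leq_mul2r leq_mul ?orbT //; lia.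
  rewrite leq_mul2r (leq_trans (subset_leq_card (subsetDl _ _))) ?orbT //.
  exact: deg.
set X := [set s in _ | _].
have XB : X \subset B1 :|: B2.
  apply/subsetP => s; rewrite inE => /andP[sP /existsP[K /and3P[sKQ TK]]].
  case/exists_inP=> x xK /exists_inP[z zK /andP[xz cxz]].
  have KU y : y \in K -> y \in U.
    move=> yK; have := subsetP (QU sKQ) (s y) (imset_f _ yK).
    by move: sP; rewrite inE => sP; rewrite perm_closed.
  have sB x' z' : x' \in K -> z' \in K -> s \in B x' z'.
    move=> x'K z'K; rewrite inE sP; apply/exists_inP; exists (s @: K) => //.
    by apply: imsetS; rewrite !subUset !sub1set x'K z'K.
  have main x' z' : x' \in K -> z' \in K -> x' != z' -> coll x' z' -> z' \notin T ->
      s \in B1 :|: B2.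
    move=> x'K z'K xz' c' z'T; rewrite in_setU; apply/orP.
    have zZ : z' \in Zs x' :\: T by rewrite in_setD z'T inE KU // eq_sym xz'.
    have [x'T|x'T] := boolP (x' \in T).
      by left; apply/bigcupP; exists x' => //; apply/bigcupP; exists z' => //; apply: sB.
    right; apply/bigcupP; exists x'; first by rewrite inE x'T KU.
    by apply/bigcupP; exists z' => //; apply: sB.
  have [zT|zT] := boolP (z \in T); last exact: (main x z).
  apply: (main z x) => //; rewrite 1?eq_sym // 1?csym //.
  by apply/negP => xT; case/negP: (Tfree _ _ xT zT xz).
have m0 : 0 < m by lia.
rewrite -(leq_pmul2l m0) mulnA.
have h3 : m * m * #|X| <= m * (m * #|B1|) + m * m * #|B2|.
  rewrite mulnA -mulnDr leq_mul2l; apply/orP; right.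
  by apply: leq_trans (subset_leq_card XB) (leq_card_setU _ _).1.
apply: leq_trans h3 _; apply: leq_trans (leq_add (leq_mul (leqnn m) h1) h2) _.
by rewrite -mulnDr leq_mul2l; apply/orP; right; apply: eq_leq; lia.
Qed.

End RandomPacking.

(** A packing that, moved by a random permutation of [U], leaves a given
[t]-set uncovered with probability at most [1/e], and covers a collision-free
one by a block with a colliding pair with probability at most [1/e].  The
relation [coll] will be agreement for another slope. *)
Definition spread_packing (t k e d : nat) (V : finType) (U : {set V})
    (Q : {set {set V}}) : Prop :=
  [/\ packing t k Q, forall K, K \in Q -> K \subset U,
      forall T : {set V}, T \subset U -> #|T| = t ->
        e * #|[set s in Perms U | ~~ [exists K in Q, s @: T \subset K]]| <= #|U|`! &
      forall (T : {set V}) (coll : rel V), T \subset U -> #|T| = t -> symmetric coll ->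
        (forall x, x \in U -> #|[set z in U | (z != x) && coll x z]| <= d) ->
        (forall x z, x \in T -> z \in T -> x != z -> ~~ coll x z) ->
        e * #|[set s in Perms U | [exists K : {set V}, [&& s @: K \in Q, T \subset K &
          [exists x in K, exists z in K, (x != z) && coll x z]]]]| <= #|U|`!].

Lemma exists_spread_packing (t k e d : nat) : 0 < t -> t <= k -> 0 < e ->
  exists m0, forall (V : finType) (U : {set V}), m0 <= #|U| -> exists Q : {set {set V}},
  spread_packing t k e d U Q.
Proof.
move=> t0 tk e0; have [m0 hm0] := inner_packing e0 t0 tk.
pose c := 2 * (t * d * (2 ^ k * t.+1)) + 4 * (d * (2 ^ k * (t.+1 * t.+2))).
exists (m0 + 2 * t.+1 + e * c) => V U mU.
have [Q0 [Q0p Q0c]] := hm0 #|U| ltac:(lia).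
have [Qp cQ] := packing_imset (@enum_val_inj V (mem U)) Q0p.
set Q := [set _ | _ in Q0] in Qp cQ.
have QU K : K \in Q -> K \subset U.
  by case/imsetP=> K0 _ ->; apply/subsetP => _ /imsetP[i _ ->]; apply: enum_valP.
have tU : t <= #|U| by lia.
exists Q; split=> // [T TU cT|T coll TU cT cs deg Tf].
  by apply: (random_uncovered Qp QU tU TU cT); rewrite cQ.
have := random_collision Qp QU tk tU TU cT cs deg Tf; rewrite -/c => /(_ ltac:(lia)).
move: #|[set s in _ | _]| => a h.
have c0 : 0 < #|U| by lia.
rewrite -(leq_pmul2l c0); apply: (@leq_trans (e * (c * #|U|`!))).
  by rewrite mulnCA leq_mul2l h orbT.
by rewrite mulnA leq_mul2r; apply/orP; right; lia.
Qed.

(** * Concentration for independent choices *)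

Section Concentration.
Import Order.TTheory GRing.Theory Num.Theory.
Local Open Scope ring_scope.

Let R : realType := Rdefinitions.R.

(** From [1 - x <= expR (- x)]. *)
Lemma expR_chord (x : R) : 0 <= x <= 1 / 2 -> expR x <= 1 + 2 * x.
Proof.
move=> /andP[x0 x1]; have h := expR_ge1Dx (- x); rewrite expRN in h.
have e0 := expR_gt0 x; have : (1 - x) * expR x <= 1.
  by rewrite -ler_pdivlMr // mul1r.
nra.
Qed.

Variables (G A : finType) (S : G -> {set A}) (b e : nat).
Hypotheses (b_gt0 : (0 < b)%N) (e_gt0 : (0 < e)%N).

Definition choices : {set {ffun G -> A}} := [set w : {ffun G -> A} | [forall g, w g \in S g]].

Lemma card_choices : #|choices| = (\prod_g #|S g|)%N.
Proof.
transitivity #|(family (fun g => mem (S g)) : simpl_pred {ffun G -> A})|.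
  apply: eq_card => w; rewrite inE; apply/forallP/familyP => h g; exact: h.
by rewrite card_family foldrE big_map big_enum.
Qed.

(** Exponential moments of [X / (2 b)]: the expectation of each factor is at most
[expR] of its mean over [b], whence the threshold of four times the mean leaves
a factor [expR (- Nn / (e * b))]. *)
Lemma chernoff (X : G -> A -> nat) (N : G -> nat) (Nn j : nat) :
  (forall g a, a \in S g -> X g a <= b)%N ->
  (forall g, e * (\sum_(a in S g) X g a) <= #|S g| * N g)%N ->
  (\sum_g N g <= Nn)%N -> (j * (e * b) <= Nn)%N ->
  (#|[set w in choices | 4 * Nn < e * \sum_g X g (w g)]| * 2 ^ j <= #|choices|)%N.
Proof.
move=> Xb XN NN jN; set bad := [set w in choices | _].
pose B : R := b%:R; pose E : R := e%:R.
have B0 : 0 < B by rewrite ltr0n.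
have E0 : 0 < E by rewrite ltr0n.
(* Markov's inequality with [T * T] on the bad choices and [T] on average. *)
pose T : R := expR (Nn%:R / (E * B)).
have T2 : (2 ^ j)%:R <= T.
  have h2 : 2%:R <= expR (1 : R) by have := expR_ge1Dx (1 : R); rewrite -natr1.
  apply: (@le_trans _ _ (expR (j%:R : R))).
    by rewrite -[j%:R]mulr1 expRM_natl natrX lerXn2r // ?nnegrE ?expR_ge0.
  by rewrite ler_expR ler_pdivlMr ?mulr_gt0 // -!natrM ler_nat.
have T0 : 0 < T by apply: expR_gt0.
pose Y (w : {ffun G -> A}) : R := expR ((\sum_g X g (w g))%N%:R / (2 * B)).
have low w : w \in bad -> T * T <= Y w.
  rewrite inE => /andP[_ h]; rewrite /T -expRD ler_expR.
  rewrite ler_pdivlMr; last by rewrite mulr_gt0.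
  have h' : 4 * Nn%:R <= E * (\sum_g X g (w g))%N%:R.
    by rewrite -!natrM ler_nat ltnW.
  have -> : (Nn%:R / (E * B) + Nn%:R / (E * B)) * (2 * B) = (4 * Nn%:R) / E.
    by field; rewrite !gt_eqF.
  by rewrite ler_pdivrMr // [leRHS]mulrC.
have up : \sum_(w in choices) Y w <= #|choices|%:R * T.
  have -> : \sum_(w in choices) Y w = \prod_g \sum_(a in S g) expR ((X g a)%:R / (2 * B)).
    rewrite bigA_distr_big_dep; apply: eq_big => w.
      rewrite inE; apply/forallP/familyP => h g; exact: h.
    by move=> _; rewrite /Y natr_sum mulr_suml expR_sum.
  apply: (@le_trans _ _ (\prod_g (#|S g|%:R * expR ((N g)%:R / (E * B))))).
    apply: ler_prod => g _; apply/andP; split; first by apply: sumr_ge0 => a _; apply: expR_ge0.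
    apply: (@le_trans _ _ (\sum_(a in S g) (1 + (X g a)%:R / B))).
      apply: ler_sum => a aS; apply: le_trans (expR_chord _) _.
        have B20 : 0 < 2 * B by rewrite mulr_gt0.
        apply/andP; split; first by rewrite divr_ge0 ?ler0n // ltW.
        rewrite ler_pdivrMr //.
        have := Xb _ _ aS; rewrite -(ler_nat R) -/B; lra.
      by rewrite le_eqVlt; apply/orP; left; apply/eqP; field; rewrite gt_eqF.
    rewrite big_split /= sumr_const -mulr_suml -natr_sum.
    apply: (@le_trans _ _ (#|S g|%:R * (1 + (N g)%:R / (E * B)))).
      rewrite mulrDr mulr1 lerD2l mulrA ler_pdivlMr ?mulr_gt0 //.
      have := XN g; rewrite -(ler_nat R) !natrM -/E => h.
      have -> : (\sum_(i in S g) X g i)%N%:R / B * (E * B) = E * (\sum_(i in S g) X g i)%N%:R.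
        by field; rewrite gt_eqF.
      exact: h.
    by rewrite ler_wpM2l ?ler0n // expR_ge1Dx.
  rewrite big_split /= -natr_prod -card_choices ler_wpM2l ?ler0n //.
  rewrite -expR_sum ler_expR -mulr_suml -natr_sum.
  by rewrite ler_wpM2r ?ler_nat // invr_ge0 mulr_ge0 // ltW.
have : #|bad|%:R * (T * T) <= #|choices|%:R * T.
  apply: le_trans up; rewrite mulr_natl -sumr_const.
  apply: (@le_trans _ _ (\sum_(w in bad) Y w)); first exact: ler_sum.
  rewrite [leRHS](bigID (mem bad)) /= ler_wpDr ?sumr_ge0 // => [w _|]; first exact: expR_ge0.
  rewrite le_eqVlt; apply/orP; left; apply/eqP; apply: eq_bigl => w.
  by rewrite [in RHS]andbC; case wb: (w \in bad) => //=; move: wb; rewrite inE => /andP[].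
rewrite mulrA ler_pM2r // => h.
rewrite -(ler_nat R) natrM; apply: le_trans h.
by rewrite ler_wpM2l ?ler0n.
Qed.

End Concentration.

Lemma concentration (G A I : finType) (S : G -> {set A}) (X : I -> G -> A -> nat)
    (N : I -> G -> nat) (b e Nn j : nat) : 0 < b -> 0 < e ->
  (forall g, S g != set0) ->
  (forall i g a, a \in S g -> X i g a <= b) ->
  (forall i g, e * (\sum_(a in S g) X i g a) <= #|S g| * N i g) ->
  (forall i, \sum_g N i g <= Nn) -> j * (e * b) <= Nn -> #|I| < 2 ^ j ->
  exists w : {ffun G -> A}, (forall g, w g \in S g) /\
    forall i, e * (\sum_g X i g (w g)) <= 4 * Nn.
Proof.
move=> b0 e0 S0 Xb XN NN jN Ij.
pose bad i := [set w in choices S | 4 * Nn < e * \sum_g X i g (w g)].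
have ch0 : 0 < #|choices S|.
  by rewrite card_choices prodn_gt0 // => g; rewrite card_gt0.
have h : #|\bigcup_(i in [set: I]) bad i| < #|choices S|.
  have : 2 ^ j * #|\bigcup_(i in [set: I]) bad i| <= #|[set: I]| * #|choices S|.
    apply: card_bigcup_bound => i _; rewrite mulnC.
    exact: (chernoff b0 e0 (Xb i) (XN i) (NN i) jN).
  rewrite cardsT => h; rewrite -(@ltn_pmul2l (2 ^ j)) ?expn_gt0 //.
  by apply: leq_ltn_trans h _; rewrite ltn_mul2r ch0.
have /subsetPn[w wC wb] : ~~ (choices S \subset \bigcup_(i in [set: I]) bad i).
  by apply/negP => /subset_leq_card; rewrite leqNgt h.
exists w; split=> [g|i]; first by move: wC; rewrite inE => /forallP.
rewrite leqNgt; apply: contra wb => hb.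
by apply/bigcupP; exists i; rewrite ?in_setT // in_set wC hb.
Qed.

(** * One family of curves *)

(** Boolean form of injectivity of [u] on [K], needed inside set comprehensions. *)
Definition separates (V : finType) (F : eqType) (u : V -> F) (K : {set V}) : bool :=
  [forall x in K, forall y in K, (u x == u y) ==> (x == y)].

Lemma separatesP (V : finType) (F : eqType) (u : V -> F) (K : {set V}) :
  reflect {in K &, injective u} (separates u K).
Proof.
apply: (iffP forall_inP) => [h x y xK yK /eqP E|h x xK].
  by apply/eqP; move/forall_inP/(_ y yK): (h x xK); rewrite E.
by apply/forall_inP => y yK; apply/implyP => /eqP E; apply/eqP; apply: h.
Qed.

Lemma separatesS (V : finType) (F : eqType) (u : V -> F) (K T : {set V}) :
  T \subset K -> separates u K -> separates u T.
Proof.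
move=> TK /separatesP h; apply/separatesP => x y /(subsetP TK) xK /(subsetP TK) yK.
exact: h.
Qed.

(** The [t]-sets inside the blocks of [P] through [S]; a block through [S] gets
lost when one of them lies in a block kept for a later slope. *)
Definition near_blocks (V : finType) (t : nat) (P : {set {set V}}) (S : {set V}) : {set {set V}} :=
  [set T : {set V} | (#|T| == t) && [exists K in P, (S \subset K) && (T \subset K)]].

Section OneDirection.

Variables (V G : finType) (F : eqType) (u : V -> F) (c : G -> {set V}).
Variables (t k e q r m0 : nat) (u' : 'I_r -> V -> F) (P' : 'I_r -> {set {set V}}).
Hypotheses (t1 : 1 < t) (tk : t <= k) (e0 : 0 < e) (q0 : 0 < q).
Hypothesis c_inj : forall g, {in c g &, injective u}.
Hypothesis c_cover : forall T : {set V}, #|T| = t -> {in T &, injective u} ->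
  exists g, T \subset c g.
Hypothesis c_meet : forall g g', t <= #|c g :&: c g'| -> g = g'.
Hypothesis c_size : forall g, #|c g| <= q.
Hypothesis c_deg : forall S : {set V}, #|S|.+1 = t -> {in S &, injective u} ->
  #|[set g | S \subset c g]| <= q.
Hypothesis c_coll : forall (i : 'I_r) g (T : {set V}), T \subset c g -> #|T| = t ->
  {in T &, injective (u' i)} ->
  forall x, x \in c g -> #|[set z in c g | (z != x) && (u' i x == u' i z)]| <= t.
Hypothesis P'_packing : forall i, packing t k (P' i).
Hypothesis P'_sep : forall i K, K \in P' i -> separates (u' i) K.
Hypothesis inner : forall (U : {set V}), m0 <= #|U| -> exists Q : {set {set V}},
  spread_packing t k e t U Q.

Lemma exists_unique_block (P : {set {set V}}) (S : {set V}) z :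
  packing t k P -> #|S|.+1 = t -> z \notin S ->
  #|[set T : {set V} | [exists K in P, (z |: S \subset K) && (T \subset K)]]| <= 2 ^ k.
Proof.
move=> [Pk Pt] cS zS; set X := [set T : {set V} | _].
have [->|[T0]] := set_0Vmem X; first by rewrite cards0.
rewrite inE => /exists_inP[K KP /andP[zK _]].
rewrite -(Pk _ KP) -card_powerset; apply/subset_leq_card/subsetP => T.
rewrite inE => /exists_inP[K' K'P /andP[zK' TK']]; rewrite inE.
suff -> : K = K' by [].
apply: Pt => //; have <- : #|z |: S| = t by rewrite cardsU1 zS.
by apply: subset_leq_card; rewrite subsetI zK.
Qed.

(** A member of [near_blocks t P S] contains a point [z] outside [S], and a
packing has at most one block through the [t]-set [z |: S]. *)
Lemma card_near_blocks_in (P : {set {set V}}) (S U : {set V}) :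
  packing t k P -> #|S|.+1 = t ->
  #|[set T in near_blocks t P S | T \subset U]| <= 2 ^ k * #|U|.
Proof.
move=> Pp cS.
apply: (@leq_trans #|\bigcup_(z in U :\: S)
    [set T : {set V} | [exists K in P, (z |: S \subset K) && (T \subset K)]]|).
  apply/subset_leq_card/subsetP => T; rewrite inE => /andP[+ TU].
  rewrite inE => /andP[/eqP cT /exists_inP[K KP /andP[SK TK]]].
  have /subsetPn[z zT zS] : ~~ (T \subset S).
    by apply/negP => /subset_leq_card; rewrite cT -cS ltnn.
  apply/bigcupP; exists z; first by rewrite inE zS (subsetP TU).
  rewrite inE; apply/exists_inP; exists K => //.
  by rewrite subUset sub1set (subsetP TK) // SK.
apply: leq_trans (leq_card_bigcup _ _) _.
apply: (@leq_trans (#|U :\: S| * 2 ^ k)).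
  rewrite -sum_nat_const; apply: leq_sum => z; rewrite inE => /andP[zS _].
  exact: exists_unique_block.
by rewrite mulnC leq_mul2l subset_leq_card ?subsetDl ?orbT.
Qed.

Definition stars (S : {set V}) : {set {set V}} := [set y |: S | y in ~: S].

Lemma card_stars_in (S U : {set V}) : #|[set T in stars S | T \subset U]| <= #|U|.
Proof.
apply: leq_trans (leq_imset_card (fun y => y |: S) U).
apply/subset_leq_card/subsetP => T; rewrite inE => /andP[/imsetP[y yS ->] h].
by apply: imset_f; move: h; rewrite subUset sub1set => /andP[].
Qed.

(** The tests are indexed by a [(t-1)]-set [S] and either the request that few
sets above [S] be uncovered, or an earlier packing [P' i] together with the
request that few sets in its blocks through [S] lie in a new block that [u' i]
does not separate.  Either way the test counts the [t]-sets of a fixed family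
for which the random packing of their curve behaves badly.  A curve contains
at most [2 ^ k * q] of them, the choices on different curves are independent,
and [concentration] applies.  Curves with fewer than [m0] points carry no
blocks; those through [S] have at most [m0 * q] points together. *)
Lemma one_direction (j : nat) :
  #|V| ^ t * r.+1 < 2 ^ j -> j * e * q <= #|V| ->
  exists P : {set {set V}}, [/\ packing t k P, forall K, K \in P -> separates u K,
    forall S : {set V}, #|S|.+1 = t -> separates u S ->
      e * #|[set y | [&& y \notin S, separates u (y |: S) & y |: S \in uncovered t P]]| <=
      4 * (2 ^ k * #|V|) + e * (m0 * q) &
    forall (S : {set V}) i, #|S|.+1 = t ->
      e * #|[set T in near_blocks t (P' i) S |
             [exists K in P, (T \subset K) && ~~ separates (u' i) K]]| <=
      4 * (2 ^ k * #|V|)].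
Proof.
move=> jV jq.
pose good g (Qg : {set {set V}}) :=
  [/\ packing t k Qg, forall K, K \in Qg -> K \subset c g /\ m0 <= #|c g| &
      m0 <= #|c g| -> spread_packing t k e t (c g) Qg].
have [Q QP] : exists Q, forall g, good g (Q g).
  apply: fin_all_exists => g; rewrite /good.
  have [big|small] := leqP m0 #|c g|.
    have [Q hQ] := inner big; have [h1 h2 _ _] := hQ.
    by exists Q; split=> // K KQ; split=> //; apply: h2.
  exists set0; split=> [|K|//]; last by rewrite inE.
  by split=> [K|K K']; rewrite inE.
(* Functions ['I_t -> V] enumerate the candidates for [S] with only [#|V| ^ t]
   indices; those whose image has a wrong size get an empty test. *)
pose S_of (f : {ffun 'I_t -> V}) : {set V} := f @: [set: 'I_t].
pose I := ({ffun 'I_t -> V} * option 'I_r)%type.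
pose TT (i : I) : {set {set V}} := if #|S_of i.1|.+1 == t then
  if i.2 is Some l then [set T in near_blocks t (P' l) (S_of i.1) | separates (u' l) T]
  else [set T in stars (S_of i.1) | #|T| == t] else set0.
pose TTg i g := [set T in TT i | (T \subset c g) && (m0 <= #|c g|)].
pose bad (i : I) g (s : {perm V}) (T : {set V}) : bool :=
  if i.2 is Some l then
    [exists K : {set V}, [&& s @: K \in Q g, T \subset K &
      [exists x in K, exists z in K, (x != z) && (u' l x == u' l z)]]]
  else ~~ [exists K in Q g, s @: T \subset K].
pose X i g s := #|[set T in TTg i g | bad i g s T]|.
have TTt i T : T \in TT i -> #|T| = t.
  rewrite /TT; case: ifP => _; last by rewrite inE.
  by case: (i.2) => [l|]; rewrite !inE => /andP[+ /eqP]; [case/andP=> /eqP|].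
have TTU i (U : {set V}) : #|[set T in TT i | T \subset U]| <= 2 ^ k * #|U|.
  rewrite /TT; case: eqP => [cS|_]; last first.
    by rewrite (_ : [set _ in _ | _] = set0) ?cards0 //; apply/setP => T; rewrite !inE.
  case: (i.2) => [l|].
    apply: leq_trans (card_near_blocks_in U (P'_packing l) cS).
    apply/subset_leq_card/subsetP => T; rewrite !in_set => /andP[/andP[-> _] ->] //.
  apply: leq_trans (leq_pmull _ _); last by rewrite expn_gt0.
  apply: leq_trans (card_stars_in (S_of i.1) U).
  by apply/subset_leq_card/subsetP => T; rewrite !in_set => /andP[/andP[-> _] ->].
pose N i g := #|TTg i g|.
have Nb i g : N i g <= 2 ^ k * q.
  apply: leq_trans (leq_mul (leqnn (2 ^ k)) (c_size g)).
  apply: leq_trans (TTU i (c g)); apply/subset_leq_card/subsetP => T.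
  by rewrite !in_set => /and3P[-> -> _].
have NN i : \sum_g N i g <= 2 ^ k * #|V|.
  apply: (@leq_trans #|[set T in TT i | T \subset [set: V]]|); last first.
    by apply: leq_trans (TTU i _) _; rewrite cardsT.
  rewrite /N (sum_card_fibers (fun g T => (T \in TT i) && ((T \subset c g) && (m0 <= #|c g|)))).
  rewrite -(card_in_imset (f := snd)).
    apply/subset_leq_card/subsetP => _ /imsetP[[g T] + ->]; rewrite !inE /=.
    by move=> /andP[-> _]; rewrite subsetT.
  move=> [g T] [g' T']; rewrite !inE /= => /and3P[h1 h2 _] /and3P[_ h2' _] E.
  rewrite -E in h2' *; congr (_, _); apply: c_meet; rewrite -(TTt _ _ h1).
  by apply: subset_leq_card; rewrite subsetI h2.
have XN i g : e * (\sum_(s in Perms (c g)) X i g s) <= #|Perms (c g)| * N i g.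
  have -> : \sum_(s in Perms (c g)) X i g s =
      \sum_(T in TTg i g) #|[set s in Perms (c g) | bad i g s T]|.
    under eq_bigr => s _ do rewrite /X -sum1_card.
    rewrite (exchange_big_dep (mem (TTg i g))) /=; last by move=> s T _; rewrite inE => /andP[].
    apply: eq_bigr => T TT'; rewrite -sum1_card; apply: eq_bigl => s.
    by rewrite [in RHS]inE [X in _ && X]inE TT'.
  rewrite big_distrr /= mulnC -sum_nat_const; apply: leq_sum => T.
  rewrite inE card_Perms => /and3P[Ti Tg mg].
  have [_ _ /(_ mg) [_ _ hA hB]] := QP g; have cT := TTt _ _ Ti.
  rewrite /bad; case E: (i.2) => [l|]; last exact: hA.
  apply: (hB T (fun x z => u' l x == u' l z) Tg cT) => [x y|x xc|x z xT zT xz].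
  - exact: eq_sym.
    move: Ti; rewrite /TT E; case: ifP => _; last by rewrite inE.
    rewrite inE => /andP[_ /separatesP h]; exact: (c_coll Tg cT h xc).
  move: Ti; rewrite /TT E; case: ifP => _; last by rewrite inE.
  rewrite inE => /andP[_ /separatesP h]; apply: contraNN xz => /eqP h'; apply/eqP.
  exact: h.
have S0 g : Perms (c g) != set0 by rewrite -card_gt0 card_Perms fact_gt0.
have Xb i g s : s \in Perms (c g) -> X i g s <= 2 ^ k * q.
  move=> _; apply: leq_trans (Nb i g); apply/subset_leq_card/subsetP => T.
  by rewrite inE => /andP[].
have jn : j * (e * (2 ^ k * q)) <= 2 ^ k * #|V|.
  have -> : j * (e * (2 ^ k * q)) = 2 ^ k * (j * e * q) by lia.
  by rewrite leq_mul2l jq orbT.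
have [w [wP wX]] := @concentration G {perm V} I (fun g => Perms (c g)) X N (2 ^ k * q) e
   (2 ^ k * #|V|) j ltac:(by rewrite muln_gt0 expn_gt0) e0 S0 Xb XN NN jn
   ltac:(by rewrite card_prod card_ffun card_option !card_ord).
(* The chosen permutation [w g] carries the blocks on curve [g] to [Q g]. *)
pose P := [set K : {set V} | [exists g, w g @: K \in Q g]].
have PP (K : {set V}) : K \in P -> exists g, w g @: K \in Q g /\ K \subset c g.
  rewrite inE => /existsP[g Kg]; exists g; split=> //; have [_ QU _] := QP g.
  apply/subsetP => x xK; have := subsetP (QU _ Kg).1 (w g x) (imset_f _ xK).
  by have := wP g; rewrite inE => wg; rewrite perm_closed.
have P_in g (T K : {set V}) : #|T| = t -> T \subset c g -> K \in P -> T \subset K ->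
    w g @: K \in Q g.
  move=> cT Tg /PP[g' [KQ Kg']] TK; suff -> : g = g' by [].
  apply: c_meet; rewrite -cT; apply: subset_leq_card.
  by rewrite subsetI Tg (subset_trans TK).
have imsetS_perm g (T K : {set V}) : (w g @: T \subset w g @: K) = (T \subset K).
  apply/subsetP/idP => [h|/subsetP h _ /imsetP[x xT ->]]; last exact/imset_f/h.
  apply/subsetP => x xT; have /imsetP[y yK /perm_inj ->] := h _ (imset_f (w g) xT).
  exact: yK.
have Pp : packing t k P.
  split=> [K /PP[g [KQ _]]|K K' KP K'P h].
    by have [[Qk _] _ _] := QP g; rewrite -(Qk _ KQ) card_imset //; apply: perm_inj.
  have [g [KQ Kg]] := PP _ KP; have [g' [K'Q K'g']] := PP _ K'P.
  have E : g = g'.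
    by apply: c_meet; apply: leq_trans h _; apply: subset_leq_card; apply: setISS.
  rewrite -E in K'Q; have [[_ Qt] _ _] := QP g.
  apply: (imset_inj (@perm_inj _ (w g))); apply: Qt => //.
  by rewrite -imsetI ?card_imset //; [apply: perm_inj|move=> x y _ _; apply: perm_inj].
have getf (S : {set V}) : #|S|.+1 = t -> exists f : {ffun 'I_t -> V}, S_of f = S.
  move=> cS; have /card_gt0P[x0 x0S] : 0 < #|S| by lia.
  exists [ffun i : 'I_t => nth x0 (enum S) i]; apply/setP => x; apply/imsetP/idP => [[i _ ->]|xS].
    rewrite ffunE; have [h|h] := ltnP i (size (enum S)); last by rewrite nth_default.
    by rewrite -mem_enum mem_nth.
  have xlt' : index x (enum S) < #|S| by rewrite cardE index_mem mem_enum.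
  have xlt : index x (enum S) < t by rewrite -cS ltnS ltnW.
  by exists (Ordinal xlt) => //; rewrite ffunE nth_index // mem_enum.
exists P; split=> // [K /PP[g [_ Kg]]|S cS Sinj|S l cS].
- by apply/separatesP => x y /(subsetP Kg) xg /(subsetP Kg) yg; apply: c_inj xg yg.
- have [f fS] := getf _ cS; have := wX (f, None).
  set sx := \sum_g _ => hX.
  have tstar y : y \notin S -> #|y |: S| = t by move=> yS; rewrite cardsU1 yS.
  pose W := [set y | [&& y \notin S, separates u (y |: S) & y |: S \in uncovered t P]].
  pose W2 := \bigcup_(g in [set g | S \subset c g])
     (if #|c g| < m0 then c g else set0).
  pose W1 := W :\: W2.
  have cW2 : #|W2| <= m0 * q.
    rewrite mulnC; apply: leq_trans (leq_card_bigcup _ _) _.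
    apply: (@leq_trans (\sum_(g in [set g | S \subset c g]) m0)).
      by apply: leq_sum => g _; case: ifP => [/ltnW //|_]; rewrite cards0.
    by rewrite sum_nat_const leq_mul2r (c_deg cS) ?orbT //; apply/separatesP.
  have cW1 : #|W1| <= sx.
    rewrite /sx /X (sum_card_fibers (fun g T => (T \in TTg (f, None) g) && bad (f, None) g (w g) T)).
    have starinj : {in W1 &, injective (fun y => y |: S)}.
      move=> y z; rewrite 2!inE => /and4P[_ yS _ _] _ E.
      by have := setU11 y S; rewrite E => /setU1P[//|]; rewrite (negbTE yS).
    rewrite -(card_in_imset starinj).
    apply: leq_trans (leq_imset_card snd _); apply/subset_leq_card/subsetP => _ /imsetP[y + ->].
    rewrite 2!inE => /and4P[yW2 yS sep unc]; have cT := tstar _ yS.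
    have [g Tg] := c_cover cT (separatesP _ _ sep).
    have TTin : y |: S \in TT (f, None).
      by rewrite /TT /= fS cS eqxx in_set cT eqxx andbT; apply: imset_f; rewrite in_setC.
    apply/imsetP; exists (g, y |: S) => //; rewrite in_set /= in_set TTin Tg /=.
    apply/andP; split.
      rewrite leqNgt; apply: contra yW2 => small; apply/bigcupP; exists g.
        by rewrite inE (subset_trans _ Tg) // subsetUr.
      by rewrite small (subsetP Tg) // setU11.
    rewrite /bad /=; apply/exists_inPn => K KQ; apply/negP => TK.
    have KE : w g @: ((w g)^-1%g @: K) = K.
      rewrite -imset_comp -[RHS]imset_id; apply: eq_imset => x; exact: permKV.
    have TK' : y |: S \subset (w g)^-1%g @: K by rewrite -(imsetS_perm g) KE.
    move: unc; rewrite inE => /andP[_ /exists_inPn/(_ ((w g)^-1%g @: K))]; rewrite TK'.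
    suff -> : (w g)^-1%g @: K \in P by move=> /(_ isT).
    by rewrite inE; apply/existsP; exists g; rewrite KE.
  have cW : #|W| <= #|W1| + #|W2|.
    rewrite -(cardsID W2 W) addnC leq_add2l; apply: subset_leq_card; exact: subsetIr.
  apply: (@leq_trans (e * (sx + m0 * q))).
    by rewrite leq_mul2l (leq_trans cW) ?orbT // leq_add.
  by rewrite mulnDr leq_add2r.
have [f fS] := getf _ cS; apply: leq_trans (wX (f, Some l)); rewrite leq_mul2l; apply/orP; right.
rewrite /X (sum_card_fibers (fun g T => (T \in TTg (f, Some l) g) && bad (f, Some l) g (w g) T)).
apply: leq_trans (leq_imset_card snd _); apply/subset_leq_card/subsetP => T.
rewrite inE => /andP[TN /exists_inP[K KP /andP[TK nK]]].
have [g [KQ Kg]] := PP _ KP; have Tg := subset_trans TK Kg.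
have [cT Tsep] : #|T| = t /\ separates (u' l) T.
  move: TN; rewrite inE => /andP[/eqP-> /exists_inP[K0 K0P /andP[_ TK0]]]; split=> //.
  exact: separatesS TK0 (P'_sep K0P).
have mg : m0 <= #|c g|.
  rewrite leqNgt; apply/negP => small; have [_ /(_ _ KQ)[_]] := QP g.
  by rewrite leqNgt small.
have TTin : T \in TT (f, Some l) by rewrite /TT /= fS cS eqxx in_set TN Tsep.
apply/imsetP; exists (g, T) => //; rewrite in_set /= in_set TTin Tg mg /=.
apply/existsP; exists K; rewrite KQ TK /=.
move: nK => /forall_inPn[x xK /forall_inPn[z zK]]; rewrite negb_imply => /andP[E xz].
by apply/exists_inP; exists x => //; apply/exists_inP; exists z => //; rewrite xz.
Qed.

End OneDirection.

(** * Curves in the plane *)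

Section Curves.
Import GRing.Theory.
Local Open Scope ring_scope.

Variables (V : finType) (F : finFieldType) (t : nat) (phi : V -> F * F).
Hypotheses (phi_inj : injective phi) (t1 : (1 < t)%N) (tF : (t <= #|F|)%N).

Definition slope (a : F) (x : V) : F := (phi x).1 + a * (phi x).2.

(** The graph of [g] over the coordinate [slope a]. *)
Definition curve (a : F) (g : 'rV[F]_t) : {set V} :=
  [set x | (phi x).2 == (rVpoly g).[slope a x]].

Lemma slope_inj a x y : slope a x = slope a y -> (phi x).2 = (phi y).2 -> x = y.
Proof.
move=> E1 E2; apply: phi_inj; rewrite [phi x]surjective_pairing [phi y]surjective_pairing.
by move: E1; rewrite /slope E2 => /addIr ->.
Qed.

Lemma slope_inj2 a b x y : a != b -> slope a x = slope a y -> slope b x = slope b y -> x = y.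
Proof.
move=> ab Ea Eb; apply: (slope_inj Ea); apply/eqP; rewrite -subr_eq0.
have : (a - b) * ((phi x).2 - (phi y).2) = 0.
  have -> : (a - b) * ((phi x).2 - (phi y).2) =
    (slope a x - slope a y) - (slope b x - slope b y) by rewrite /slope; ring.
  by rewrite Ea Eb !subrr.
by move/eqP; rewrite mulf_eq0 [a - b == 0]subr_eq0 (negbTE ab).
Qed.

Lemma curve_inj a g : {in curve a g &, injective (slope a)}.
Proof.
move=> x y; rewrite !inE => /eqP xg /eqP yg E.
by apply: (slope_inj E); rewrite xg yg E.
Qed.

Lemma curve_size a g : (#|curve a g| <= #|F|)%N.
Proof. by rewrite -(card_in_imset (@curve_inj a g)) max_card. Qed.

Lemma column_size a x : (#|[set y | slope a y == slope a x]| <= #|F|)%N.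
Proof.
rewrite -(card_in_imset (f := fun y => (phi y).2)) ?max_card //.
move=> y z; rewrite !inE => /eqP Ey /eqP Ez; apply: (@slope_inj a).
by rewrite Ey Ez.
Qed.

Lemma curve_cover a (T : {set V}) : #|T| = t -> {in T &, injective (slope a)} ->
  exists g, T \subset curve a g.
Proof.
move=> cT Tinj.
have us : uniq (map (slope a) (enum T)).
  rewrite map_inj_in_uniq ?enum_uniq // => x y; rewrite !mem_enum; exact: Tinj.
have [p sp pE] := interpolation (fun x => (phi x).2) us.
rewrite -cardE cT in sp.
exists (poly_rV p); apply/subsetP => x xT; rewrite inE poly_rV_K //.
by rewrite pE ?mem_enum.
Qed.

Lemma poly_agree (rs : seq F) (g g' : 'rV[F]_t) : uniq rs -> (t <= size rs)%N ->
  {in rs, forall z, (rVpoly g).[z] = (rVpoly g').[z]} -> g = g'.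
Proof.
move=> urs st E; suff : rVpoly g - rVpoly g' == 0.
  by rewrite subr_eq0 => /eqP E'; rewrite -[g]rVpolyK E' rVpolyK.
apply/negPn/negP => n0.
have sz : (size (rVpoly g - rVpoly g')%R <= t)%N.
  by apply: leq_trans (size_polyD _ _) _; rewrite size_polyN geq_max !size_poly.
have := max_poly_roots n0 (rs := rs).
rewrite urs ltnNge (leq_trans sz st) => h.
suff /h/(_ isT) : all (root (rVpoly g - rVpoly g')) rs by [].
by apply/allP => z zr; rewrite rootE !hornerE E // subrr.
Qed.

Lemma curve_meet a g g' : (t <= #|curve a g :&: curve a g'|)%N -> g = g'.
Proof.
move=> h; apply: (@poly_agree (map (slope a) (enum (curve a g :&: curve a g')))).
- rewrite map_inj_in_uniq ?enum_uniq // => x y; rewrite !mem_enum => /setIP[xg _] /setIP[yg _].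
  exact: (curve_inj xg yg).
- by rewrite size_map -cardE.
move=> _ /mapP[x + ->]; rewrite mem_enum !inE => /andP[/eqP <- /eqP <-] //.
Qed.

(** Besides the [t - 1] points of [S], one further value at a node [z0] outside
[slope a @: S] determines the polynomial. *)
Lemma curve_deg a (S : {set V}) : #|S|.+1 = t -> {in S &, injective (slope a)} ->
  (#|[set g | S \subset curve a g]| <= #|F|)%N.
Proof.
move=> cS Sinj.
have [z0 z0S] : exists z0, z0 \notin map (slope a) (enum S).
  have : (#|[set z in map (slope a) (enum S)]| < #|F|)%N.
    rewrite cardsE; apply: leq_ltn_trans (card_size _) _.
    by rewrite size_map -cardE; apply: leq_trans tF; rewrite cS.
  rewrite ltnNge => /negP h; have /subsetPn[z _ zn] : ~~ ([set: F] \subset [set z in map (slope a) (enum S)]).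
    by apply/negP => /subset_leq_card; rewrite cardsT.
  by exists z; rewrite inE in zn.
rewrite -(card_in_imset (f := fun g => (rVpoly g).[z0])) ?max_card //.
move=> g g'; rewrite !inE => Sg Sg' E.
apply: (@poly_agree (z0 :: map (slope a) (enum S))).
- rewrite /= z0S map_inj_in_uniq ?enum_uniq // => x y; rewrite !mem_enum; exact: Sinj.
- by rewrite /= size_map -cardE cS.
move=> z; rewrite inE => /predU1P[-> //|/mapP[x + ->]]; rewrite mem_enum => xS.
have := subsetP Sg _ xS; have := subsetP Sg' _ xS.
by rewrite !inE => /eqP <- /eqP <-.
Qed.

(** Along the curve, [slope b] is a polynomial of degree less than [t] in
[slope a].  It is not constant, since [slope b] is injective on the [t > 1]
points of [T], so it takes each value fewer than [t] times. *)
Lemma curve_coll a b g (T : {set V}) : T \subset curve a g -> #|T| = t ->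
  {in T &, injective (slope b)} ->
  forall x, x \in curve a g ->
  (#|[set z in curve a g | (z != x) && (slope b x == slope b z)]| <= t)%N.
Proof.
move=> Tg cT Tinj x xg.
(* [slope b] in terms of [slope a] on the curve. *)
pose h : {poly F} := 'X + (b - a)%:P * rVpoly g.
have hE z : z \in curve a g -> slope b z = h.[slope a z].
  by rewrite inE => /eqP zg; rewrite /h !hornerE -zg /slope; ring.
pose h' := h - (slope b x)%:P.
have h'0 : h' != 0.
  apply/eqP => h0; have hc z : z \in curve a g -> slope b z = slope b x.
    move=> zg; rewrite (hE _ zg); have -> : h = (slope b x)%:P by apply/eqP; rewrite -subr_eq0 -/h' h0.
    by rewrite hornerC.
  have /card_gt1P[y [z [yT zT /eqP yz]]] : (1 < #|T|)%N by rewrite cT.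
  by apply: yz; apply: Tinj => //; rewrite !hc // (subsetP Tg).
have sh' : (size h' <= t)%N.
  apply: leq_trans (size_polyD _ _) _; rewrite geq_max size_polyN.
  rewrite (leq_trans (size_polyC_leq1 _)) ?(ltnW t1) // andbT.
  apply: leq_trans (size_polyD _ _) _; rewrite geq_max size_polyX t1 /=.
  by rewrite mul_polyC (leq_trans (size_scale_leq _ _)) // size_poly.
set Z := [set z in _ | _].
have Zinj : {in Z &, injective (slope a)}.
  by move=> y z; rewrite !inE => /andP[yg _] /andP[zg _]; apply: (@curve_inj a g); rewrite inE.
have := max_poly_roots h'0 (rs := map (slope a) (enum Z)).
rewrite size_map -cardE => lt; apply: ltnW; apply: leq_trans sh'; apply: lt.
  apply/allP => _ /mapP[z + ->]; rewrite mem_enum inE => /and3P[zg _ /eqP E].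
  by rewrite rootE /h' hornerD hornerN hornerC -hE // E subrr.
by rewrite map_inj_in_uniq ?enum_uniq // => y z; rewrite !mem_enum; apply: Zinj.
Qed.

(** A slope that does not separate [S] yields a pair of distinct points of [S]
that agree for it, and different slopes yield different pairs. *)
Lemma exists_separating (R : nat) (alpha : nat -> F) (S : {set V}) :
  (forall i j, (i < R)%N -> (j < R)%N -> alpha i = alpha j -> i = j) ->
  (#|S| * #|S| < R)%N -> exists2 i, (i < R)%N & separates (slope (alpha i)) S.
Proof.
move=> ainj SR.
have [i sep|no] := pickP (fun i : 'I_R => separates (slope (alpha i)) S).
  by exists i.
pose collide (i : 'I_R) (p : V * V) := [/\ p.1 \in S, p.2 \in S, p.1 != p.2 &
  slope (alpha i) p.1 = slope (alpha i) p.2].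
have [f fP] : exists f, forall i, collide i (f i).
  apply: fin_all_exists => i; have := no i => /forall_inPn[x xS /forall_inPn[y yS]].
  by rewrite negb_imply => /andP[/eqP E xy]; exists (x, y).
have finj : injective f.
  move=> i j E; apply/val_inj/ainj; rewrite ?ltn_ord //; apply/eqP/negPn/negP => ij.
  have [_ _ /eqP xy Ei] := fP i; have [_ _ _ Ej] := fP j; rewrite -E in Ej.
  by apply: xy; apply: (slope_inj2 ij Ei Ej).
have : (#|'I_R| <= #|setX S S|)%N.
  rewrite -(card_imset _ finj); apply/subset_leq_card/subsetP => _ /imsetP[i _ ->].
  by have [h1 h2 _ _] := fP i; rewrite inE h1 h2.
by rewrite card_ord cardsX leqNgt SR.
Qed.

End Curves.

Section AllDirections.

Variables (V : finType) (F : finFieldType) (t k e m0 R : nat) (phi : V -> F * F) (alpha : nat -> F).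
Hypotheses (phi_inj : injective phi) (t1 : 1 < t) (tF : t <= #|F|) (tk : t <= k) (e0 : 0 < e).
Hypothesis inner : forall (U : {set V}), m0 <= #|U| -> exists Q : {set {set V}},
  spread_packing t k e t U Q.

Let u j := slope phi (alpha j).

(** The slopes are treated one after the other, so that the packings of the
earlier slopes are fixed when [one_direction] draws the packing of slope [j]. *)
Lemma all_directions (l J : nat) : #|V| ^ t * R < 2 ^ l -> l * e * #|F| <= #|V| -> J <= R ->
  exists P : nat -> {set {set V}}, forall j, j < J ->
  [/\ packing t k (P j), forall K, K \in P j -> separates (u j) K,
    forall S : {set V}, #|S|.+1 = t -> separates (u j) S ->
      e * #|[set y | [&& y \notin S, separates (u j) (y |: S) & y |: S \in uncovered t (P j)]]| <=
      4 * (2 ^ k * #|V|) + e * (m0 * #|F|) &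
    forall (S : {set V}) i, i < j -> #|S|.+1 = t ->
      e * #|[set T in near_blocks t (P i) S |
             [exists K in P j, (T \subset K) && ~~ separates (u i) K]]| <=
      4 * (2 ^ k * #|V|)].
Proof.
move=> hl lV; elim: J => [|J IH] JR; first by exists (fun=> set0).
have [P PP] := IH (ltnW JR).
have q0 : 0 < #|F| by apply: leq_trans tF; apply: ltnW.
have [Pn [h1 h2 h3 h4]] := @one_direction V 'rV[F]_t F (u J) (curve phi (alpha J)) t k e #|F| J m0
  (fun i : 'I_J => u i) (fun i : 'I_J => P i) t1 tk e0 q0
  (@curve_inj _ _ _ _ phi_inj (alpha J)) (@curve_cover _ _ _ _ (alpha J))
  (@curve_meet _ _ _ _ phi_inj (alpha J)) (@curve_size _ _ _ _ phi_inj (alpha J))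
  (@curve_deg _ _ _ _ tF (alpha J))
  (fun i => @curve_coll _ _ _ _ phi_inj t1 (alpha J) (alpha i))
  (fun i => let: And4 p _ _ _ := PP i (ltn_ord i) in p)
  (fun i => let: And4 _ p _ _ := PP i (ltn_ord i) in p) inner l
  (leq_ltn_trans (leq_mul (leqnn _) JR) hl) lV.
exists (fun j => if j == J then Pn else P j) => j; rewrite ltnS leq_eqVlt => /orP[/eqP->|jJ].
  rewrite eqxx; split=> // S i iJ cS; rewrite (ltn_eqF iJ).
  exact: (h4 S (Ordinal iJ) cS).
have [g1 g2 g3 g4] := PP _ jJ; rewrite (ltn_eqF jJ); split=> // S i ij cS.
by rewrite (ltn_eqF (ltn_trans ij jJ)); apply: g4.
Qed.

End AllDirections.

(** * Merging the slopes *)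

Section Combine.

Variables (V : finType) (F : eqType) (u : nat -> V -> F) (P : nat -> {set {set V}}).
Variables (R t k e q a b : nat).
Hypothesis P_packing : forall j, j < R -> packing t k (P j).
Hypothesis P_sep : forall j K, j < R -> K \in P j -> separates (u j) K.
Hypothesis P_left : forall j (S : {set V}), j < R -> #|S|.+1 = t -> separates (u j) S ->
  e * #|[set y | [&& y \notin S, separates (u j) (y |: S) & y |: S \in uncovered t (P j)]]| <= a.
Hypothesis P_hit : forall i j (S : {set V}), i < j -> j < R -> #|S|.+1 = t ->
  e * #|[set T in near_blocks t (P i) S |
         [exists K in P j, (T \subset K) && ~~ separates (u i) K]]| <= b.
Hypothesis columns : forall j x, #|[set y | u j y == u j x]| <= q.
Hypothesis separating : forall S : {set V}, #|S|.+1 = t ->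
  exists2 j, j < R & separates (u j) S.

(** Only these blocks of [P j] are needed: a [t]-set separated by an earlier slope
is the task of that slope. *)
Definition residual (j : nat) : {set {set V}} :=
  [set K in P j | [forall i : 'I_j, ~~ separates (u i) K]].

(** Later slopes take precedence: a block is dropped when it shares [t] points
with a residual block of a later slope. *)
Definition combined : {set {set V}} :=
  [set K | [exists i : 'I_R, (K \in residual i) &&
    [forall j : 'I_R, (i < j) ==> [forall K' in residual j, #|K :&: K'| < t]]]].

Lemma combinedP K : reflect (exists i, [/\ i < R, K \in residual i &
    forall j K', i < j -> j < R -> K' \in residual j -> #|K :&: K'| < t]) (K \in combined).
Proof.
rewrite inE; apply: (iffP existsP) => [[i /andP[Ki /forallP h]]|[i [iR Ki h]]].
  exists i; split=> // j K' ij jR K'j.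
  by move/implyP/(_ ij)/forall_inP/(_ _ K'j): (h (Ordinal jR)).
exists (Ordinal iR); rewrite Ki; apply/forallP => j; apply/implyP => ij.
by apply/forall_inP => K' K'j; apply: (h j) => //; apply: ltn_ord.
Qed.

Lemma residual_sub j K : K \in residual j -> K \in P j.
Proof. by rewrite inE => /andP[]. Qed.

Lemma combined_packing : packing t k combined.
Proof.
split=> [K /combinedP[i [iR /residual_sub KP _]]|K K'].
  by have [h _] := P_packing iR; apply: h.
move=> /combinedP[i [iR Ki hi]] /combinedP[j [jR K'j hj]] h.
have [ij|ji|ij] := ltngtP i j.
- by have := hi _ _ ij jR K'j; rewrite ltnNge h.
- by have := hj _ _ ji iR Ki; rewrite setIC ltnNge h.
rewrite -ij in K'j; have [_ Pt] := P_packing iR.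
by apply: Pt => //; apply: residual_sub.
Qed.

(** Let [i] be the first slope that separates [S].  If [y |: S] is uncovered, then
either [y] agrees with a point of [S] for slope [i], or [P i] does not cover
[y |: S], or the block of [P i] through it was dropped.  In the last case the
block shares a [t]-set [T] with a block of a later slope [j], and [T] is counted
by [P_hit]; each [T] accounts for at most [k] points [y], the points of the
unique block of [P i] above [T]. *)
Lemma combined_uncovered (S : {set V}) : #|S|.+1 = t ->
  e * #|[set y | (y \notin S) && (y |: S \in uncovered t combined)]| <=
  e * (t * q) + a + R * (k * b).
Proof.
move=> cS.
have [i [iR Si imin]] : exists i, [/\ i < R, separates (u i) S &
    forall j, j < i -> ~~ separates (u j) S].
  have ex : exists i, separates (u i) S by have [i _ h] := separating cS; exists i.
  have [i Si imin] := ex_minnP ex; have [j jR Sj] := separating cS.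
  exists i; split=> //; first exact: leq_ltn_trans (imin _ Sj) jR.
  by move=> l li; apply/negP => /imin; rewrite leqNgt li.
(* The three reasons for [y |: S] to be uncovered, in turn. *)
pose C := \bigcup_(x in S) [set y | u i y == u i x].
pose A := [set y | [&& y \notin S, separates (u i) (y |: S) & y |: S \in uncovered t (P i)]].
pose T_of (j : 'I_R) := [set T in near_blocks t (P i) S |
         [exists K in P j, (T \subset K) && ~~ separates (u i) K]].
pose D := \bigcup_(j in [set j : 'I_R | i < j]) \bigcup_(T in T_of j)
  [set y | [exists K in P i, (T \subset K) && (y \in K)]].
have cC : #|C| <= t * q.
  apply: leq_trans (leq_card_bigcup _ _) _.
  apply: (@leq_trans (#|S| * q)); last by rewrite leq_mul2r -cS leqnSn orbT.
  by rewrite -sum_nat_const; apply: leq_sum => x _.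
have cD : e * #|D| <= R * (k * b).
  apply: (@leq_trans (#|[set j : 'I_R | i < j]| * (k * b))).
    apply: card_bigcup_bound => j; rewrite inE => ij.
    apply: (@leq_trans (k * (e * #|T_of j|))); last first.
      by rewrite leq_mul2l (P_hit ij (ltn_ord j) cS) orbT.
    rewrite mulnCA leq_mul2l [k * _]mulnC -[X in X <= _]mul1n.
    apply/orP; right; apply: card_bigcup_bound => T; rewrite inE => /andP[+ _].
    rewrite inE mul1n => /andP[/eqP cT /exists_inP[K KP /andP[_ TK]]].
    have [Pk Pt] := P_packing iR; rewrite -(Pk _ KP).
    apply/subset_leq_card/subsetP => y; rewrite inE => /exists_inP[K' K'P /andP[TK' yK']].
    suff -> : K = K' by [].
    by apply: Pt => //; rewrite -cT subset_leq_card // subsetI TK.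
  rewrite leq_mul2r; apply/orP; right; rewrite -[leqRHS]card_ord; exact: max_card.
have cA : e * #|A| <= a by apply: P_left.
set W := [set y | _].
have WCAD : W \subset C :|: A :|: D.
  apply/subsetP => y; rewrite inE => /andP[yS yunc].
  have cT : #|y |: S| = t by rewrite cardsU1 yS.
  have [sep|nsep] := boolP (separates (u i) (y |: S)); last first.
    rewrite -setUA; apply/setUP; left.
    have [x xS E] : exists2 x, x \in S & u i y = u i x.
      move: nsep => /forall_inPn[x xT /forall_inPn[z zT]]; rewrite negb_imply => /andP[/eqP E xz].
      move: xT zT => /setU1P[xy|xS] /setU1P[zy|zS].
      - by rewrite xy zy eqxx in xz.
      - by exists z; rewrite // -xy.
      - by exists x; rewrite // -zy.
      - by case/eqP: xz; apply: (separatesP _ _ Si).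
    by apply/bigcupP; exists x; rewrite // inE E.
  have [unc|cov] := boolP (y |: S \in uncovered t (P i)).
    by apply/setUP; left; apply/setUP; right; rewrite inE yS sep unc.
  apply/setUP; right.
  have /exists_inP[K KP TK] : [exists K in P i, y |: S \subset K].
    by move: cov; rewrite inE cT eqxx negbK.
  have SK : S \subset K by apply: subset_trans TK; apply: subsetUr.
  have Kres : K \in residual i.
    rewrite inE KP; apply/forallP => j; apply: contra (imin j (ltn_ord j)).
    exact: separatesS.
  have Knot : K \notin combined.
    apply: contraL yunc => KC; rewrite inE cT eqxx negbK.
    by apply/exists_inP; exists K.
  have [j [ij jR [K' K'j KK']]] : exists j, [/\ i < j, j < R & exists2 K', K' \in residual j &
      t <= #|K :&: K'|].
    move: Knot; rewrite inE => /existsPn/(_ (Ordinal iR)); rewrite Kres /=.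
    case/forallPn=> j; rewrite negb_imply => /andP[ij /forall_inPn[K' K'j]].
    by rewrite -leqNgt => h; exists j; split=> //; exists K'.
  have [T cT' TKK'] : exists2 T : {set V}, #|T| = t & T \subset K :&: K'.
    have /card_geqP[s [us ss sK]] := KK'.
    exists [set x in s]; first by rewrite cardsE (card_uniqP us) ss.
    by apply/subsetP => x; rewrite inE; apply: sK.
  have [TK1 TK2] : T \subset K /\ T \subset K' by move: TKK'; rewrite subsetI => /andP.
  apply/bigcupP; exists (Ordinal jR); first by rewrite inE.
  apply/bigcupP; exists T; last first.
    rewrite inE; apply/exists_inP; exists K => //.
    by rewrite TK1 (subsetP TK) // setU11.
  rewrite inE; apply/andP; split.
    by rewrite inE cT' eqxx; apply/exists_inP; exists K => //; rewrite SK.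
  apply/exists_inP; exists K'; first exact: residual_sub K'j.
  rewrite TK2 /=; move: K'j; rewrite inE => /andP[_ /forallP/(_ (Ordinal ij))] //.
have cW : #|W| <= #|C| + #|A| + #|D|.
  apply: leq_trans (subset_leq_card WCAD) _; apply: leq_trans (leq_card_setU _ _).1 _.
  by rewrite leq_add2r (leq_card_setU _ _).1.
apply: (@leq_trans (e * (#|C| + #|A| + #|D|))); first by rewrite leq_mul2l cW orbT.
rewrite !mulnDr !leq_add //.
by rewrite leq_mul2l cC orbT.
Qed.

End Combine.

(** * Existence *)

Lemma linear_le_exp (C : nat) : exists r1, forall r, r1 <= r -> C * r.+1 <= 2 ^ r.
Proof.
exists (C.+1 + C * C.+1) => r hr.
pose s := r - C.+1; have E : r = C.+1 + s by rewrite /s; lia.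
have hs : C * C.+1 <= s by rewrite /s; lia.
rewrite {2}E expnD E.
have h1 : C.+2 <= 2 ^ C.+1 by apply: ltn_expl.
have h2 : s.+1 <= 2 ^ s by apply: ltn_expl.
by apply: leq_trans (leq_mul h1 h2); lia.
Qed.

(** The field is the one with [2 ^ r] elements for the least [r] with
[n <= 4 ^ r], so that its order [q] satisfies [n <= q ^ 2 <= 4 n].  The number
of tests is a power of [q] with constant exponent, so its logarithm [l] is
linear in [r], far below the ratio [n / (e * q)]. *)
Lemma near_perfect_packing (E k t : nat) : 2 <= t -> t <= k ->
  exists n0 : nat, forall n : nat, n0 <= n ->
    exists Q : {set {set 'I_n}}, packing t k Q /\
      forall S : {set 'I_n}, #|S|.+1 = t ->
        E * #|[set y | (y \notin S) && (y |: S \in uncovered t Q)]| <= n.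
Proof.
move=> t2 tk; have t0 : 0 < t by apply: leq_trans t2.
pose R := (t * t).+1.
(* Half of the allowance [n / E] pays for the terms proportional to [n / e],
   the other half for those proportional to [q]. *)
pose e := 2 * (E * (4 * 2 ^ k * (1 + R * k))) + 1.
have e0 : 0 < e by rewrite /e addn1.
have [m0 inner] := exists_spread_packing t t0 tk e0.
(* [C * r.+1 <= q] covers every requirement on the size of the field. *)
pose C := 4 * (2 * t + R.+1) * e + 8 * E * e * (t + m0) + R + t.
have [r1 hr1] := linear_le_exp C.
exists (4 ^ r1 + 2) => n hn.
pose r := up_log 4 n.
have /andP[nl nu] := up_log_bounds (isT : 1 < 4) (ltac:(lia) : 1 < n).
rewrite -/r in nl nu.
have r1r : r1 <= r.
  by rewrite -(leq_exp2l (m := 4)) //; apply: leq_trans nu; lia.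
have r0 : 0 < r by rewrite up_log_gt0 /=; lia.
have [F _ cF] := @pPrimePowerField 2 r isT r0.
set q := #|F| in cF.
have qq : q * q = 4 ^ r by rewrite cF -expnMn.
have nq : n <= q * q by rewrite qq.
have qn : q * q <= 4 * n by rewrite qq -(prednK r0) expnS leq_mul2l ltnW.
have Cq : C * r.+1 <= q by rewrite cF; apply: hr1.
have [phi phi_inj] : exists phi : 'I_n -> F * F, injective phi.
  by apply: exists_injection; rewrite card_ord card_prod.
have Cq' : C <= q by apply: leq_trans Cq; apply: leq_pmulr.
pose alpha (i : nat) : F := nth 0%R (enum F) i.
have alpha_inj i j : i < R -> j < R -> alpha i = alpha j -> i = j.
  have lt l : l < R -> l < size (enum F).
    by move=> lR; rewrite -cardT; apply: leq_trans lR _; rewrite -/q; apply: leq_trans Cq'; rewrite /C; lia.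
  by move=> iR jR /eqP; rewrite nth_uniq ?enum_uniq ?lt // => /eqP.
have tF : t <= #|F| by rewrite -/q; apply: leq_trans Cq'; rewrite /C; lia.
pose l := 2 * r * t + R.+1.
have hl : #|'I_n| ^ t * R < 2 ^ l.
  rewrite card_ord /l expnD; apply: (@leq_ltn_trans (2 ^ (2 * r * t) * R)).
    rewrite leq_mul2r; apply/orP; right.
    by rewrite expnM leq_exp2r // (leq_trans nu) // (expnM 2 2).
  by rewrite ltn_pmul2l ?expn_gt0 //; apply: ltn_trans (ltnSn R) (ltn_expl _ _).
have lV : l * e * #|F| <= #|'I_n|.
  rewrite card_ord -/q.
  have h : 4 * (l * e) <= q.
    apply: leq_trans Cq; apply: (@leq_trans (4 * (2 * t + R.+1) * e * r.+1)); last first.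
      by rewrite leq_mul2r; apply/orP; right; rewrite /C; lia.
    have : l <= (2 * t + R.+1) * r.+1 by rewrite /l; nia.
    by move=> /(fun h => leq_mul (leqnn (4 * e)) h); lia.
  by have := leq_mul h (leqnn q); lia.
have [P PP] := @all_directions 'I_n F t k e m0 R phi alpha phi_inj t2 tF tk e0
  (inner 'I_n) l R hl lV (leqnn R).
have sep (S : {set 'I_n}) : #|S|.+1 = t -> exists2 j, j < R & separates (slope phi (alpha j)) S.
  move=> cS; apply: (exists_separating phi_inj alpha_inj).
  by rewrite ltnS leq_mul // -cS leqnSn.
have Qp := @combined_packing 'I_n F (fun j => slope phi (alpha j)) P R t k
  (fun j jR => let: And4 p _ _ _ := PP j jR in p).
have Qu := @combined_uncovered 'I_n F (fun j => slope phi (alpha j)) P R t k e q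
  (4 * (2 ^ k * #|'I_n|) + e * (m0 * q)) (4 * (2 ^ k * #|'I_n|))
  (fun j jR => let: And4 p _ _ _ := PP j jR in p)
  (fun j S jR => let: And4 _ _ p _ := PP j jR in p S)
  (fun i j S ij jR => let: And4 _ _ _ p := PP j jR in p S i ij)
  (fun j x => column_size phi_inj (alpha j) x) sep.
exists (combined (fun j => slope phi (alpha j)) P R t); split=> // S cS; have := Qu S cS; rewrite card_ord.
move: #|[set y | _]| => x hx.
pose D := 4 * 2 ^ k * (1 + R * k).
have eD : e = 2 * (E * D) + 1 by [].
have h1 : 2 * E * e * (t + m0) * q <= n.
  have h : 8 * E * e * (t + m0) <= q by apply: leq_trans Cq'; rewrite /C; lia.
  by have := leq_mul h (leqnn q); lia.
have h2 : e * x <= e * (t + m0) * q + D * n.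
  by apply: leq_trans hx _; apply: eq_leq; rewrite /D; lia.
have h3 : e * (E * x) <= e * n.
  have := leq_mul (leqnn (2 * E)) h2; have : 2 * E * (D * n) + n = e * n by rewrite eD; lia.
  by lia.
by rewrite leq_pmul2l in h3.
Qed.

Theorem theorem2 (k t : nat) (ht : 2 <= t) (htk : t < k) :
  exists n0 : nat, forall n : nat, n0 <= n ->
    exists (X : finType) (F : {set {set X}}), is_design t n k (pred2 1 2) F.
Proof.
have [E [n1 augment]] := augment_packing (ltnW ht) htk.
have [n2 near] := near_perfect_packing E ht (ltnW htk).
exists (n1 + n2 + k.+1) => n hn; have [Q [Qp Qu]] := near n ltac:(lia).
have [||F [Fk Fc]] := augment 'I_n Q _ Qp; rewrite ?card_ord //; first by lia.
exists 'I_n, F; split=> //; last exact: card_ord.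
  by rewrite ht htk; split=> //; lia.
by move=> d /pred2P[] ->.
Qed.
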